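(* Let $Q$ be an acyclic source freezing quiver, with frozen vertices $z_1,\dots,z_m$, and let $\mathbb{Z}\mathbb{P}_+=\mathbb{Z}[z_1,\dots,z_m]$. Then the cluster algebra $\mathcal{A}$ and the upper cluster algebra $\mathcal{U}$ defined by $Q$ over the ground ring $\mathbb{Z}\mathbb{P}_+$ are equal: $\mathcal{A}=\mathcal{U}$.
   Context: The tropical semifield $\mathbb{P}=\mathrm{Trop}(z_1,\dots,z_m)$ is the free abelian group (written multiplicatively) generated by $z_1,\dots,z_m$, with auxiliary addition $\prod_i z_i^{a_i}\oplus\prod_i z_i^{b_i}=\prod_i z_i^{\min(a_i,b_i)}$. Its group ring is $\mathbb{Z}\mathbb{P}=\mathbb{Z}[z_1^{\pm1},\dots,z_m^{\pm1}]$, and $\mathbb{Z}\mathbb{P}_+=\mathbb{Z}[z_1,\dots,z_m]$ is the polynomial subring. Seeds. Let $\mathcal{F}$ be a field containing $\mathbb{Z}\mathbb{P}$. A seed of rank $n$ in $\mathcal{F}$ is a triple $(B,\mathbf{x},\mathbf{y})$ where $\mathbf{x}=(x_1,\dots,x_n)$ (the cluster) is an $n$-tuple in $\mathcal{F}$ freely generating $\mathcal{F}$ as a field over the fraction field of $\mathbb{Z}\mathbb{P}$, $\mathbf{y}=(y_1,\dots,y_n)$ is an $n$-tuple in $\mathbb{P}$, and $B$ is an integral skew-symmetrizable $n\times n$ matrix. Mutation. Write $[a]_+=\max(a,0)$. For $1\le k\le n$ the mutation of a seed in direction $k$ is the seed $(\mu_k(B),\mu_k(\mathbf{x}),\mu_k(\mathbf{y}))$,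 where $\mu_k(\mathbf{x})$ is obtained from $\mathbf{x}$ by replacing $x_k$ with $x_k'=\dfrac{y_k\prod_j x_j^{[B_{jk}]_+}+\prod_j x_j^{[-B_{jk}]_+}}{(y_k\oplus 1)x_k}$; $\mu_k(\mathbf{y})=(y_1',\dots,y_n')$ with $y_k'=y_k^{-1}$ and $y_i'=y_iy_k^{[B_{ki}]_+}(y_k\oplus 1)^{-B_{ki}}$ for $i\ne k$; and $\mu_k(B)_{ij}=-B_{ij}$ if $i=k$ or $j=k$, and $\mu_k(B)_{ij}=B_{ij}+\frac12(|B_{ik}|B_{kj}+B_{ik}|B_{kj}|)$ otherwise. Two seeds are mutation equivalent if one is obtained from the other by a sequence of mutations, up to permuting indices. Cluster algebras. The cluster variables are the elements of the clusters of all seeds mutation equivalent to $(B,\mathbf{x},\mathbf{y})$. For a ground ring $\mathbb{Z}\subseteq\mathbb{A}\subseteq\mathbb{Z}\mathbb{P}$, the cluster algebra over $\mathbb{A}$ is the unital $\mathbb{A}$-subalgebra of $\mathcal{F}$ generated by all cluster variables, and the upper cluster algebra over $\mathbb{A}$ is $\bigcap\mathbb{A}[(x_1')^{\pm1},\dots,(x_n')^{\pm1}]$, the intersection over all clusters $(x_1',\dots,x_n')$ of seeds mutation equivalent to $(B,\mathbf{x},\mathbf{y})$. Quivers. A quiver is a finite directed graph without loops or directed $2$-cycles; parallel arrows are allowed. Its vertices are divided into mutable vertices $1,\dots,n$ and frozen vertices $z_1,\dots,z_m$, with no arrows between frozen vertices. A quiver $Q$ defines a seed $(B,\mathbf{x},\mathbf{y})$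 over $\mathbb{P}=\mathrm{Trop}(z_1,\dots,z_m)$: $B$ is skew-symmetric with $B_{ji}$ equal to the number of arrows $i\to j$ minus the number of arrows $j\to i$ between mutable vertices, and $y_i=\prod_j z_j^{a_j}$ with $a_j$ equal to the number of arrows $i\to z_j$ minus the number of arrows $z_j\to i$. The cluster algebra and upper cluster algebra defined by $Q$ are those of this seed. $Q$ is acyclic if the seed it defines is acyclic, i.e. there is no directed cycle of mutable vertices. $Q$ is a source freezing quiver if all arrows involving frozen vertices are directed from a mutable vertex to a frozen vertex. *)

(* Defs.v *)
From mathcomp Require Import all_boot all_order all_fingroup all_algebra.
From mathcomp Require Import boolp classical_sets.
From mathcomp Require Import mpoly.
From mathcomp Require monalg.

Set Implicit Arguments.
Unset Strict Implicit.
Unset Printing Implicit Defensive.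

Import Order.TTheory GRing.Theory Num.Theory.
Local Open Scope classical_set_scope.
Local Open Scope ring_scope.

(* An element prod_i z_i ^ (a i) of the tropical semifield Trop(z_1, .., z_m)
   is its exponent vector a.  The (multiplicative) group law of Trop is thus the
   addition of exponent vectors, its unit is 0, and powers are written *~.    *)
Definition trop (m : nat) : zmodType := {ffun 'I_m -> int}.

(* The auxiliary addition of the semifield. *)
Definition trop_oplus (m : nat) (a b : trop m) : trop m :=
  [ffun i => Num.min (a i) (b i)].

(* The group ring of Trop, as the free Z-module on Trop.  Its product is not
   needed because it is only used through its image in a field; monalg itself
   provides the product only for monoids without nontrivial units. *)
Definition group_ring (m : nat) : Type := monalg.malg (trop m) int.

Section Seeds.

Variables (F : fieldType) (n m : nat).

(* The elements of F that play the role of z_1, .., z_m. *)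
Variable z : 'I_m -> F.

Definition trop_val (a : trop m) : F := \prod_(i < m) z i ^ a i.

Definition group_ring_val (g : group_ring m) : F :=
  monalg.mmap intr trop_val g.

(* The map from the group ring to F induced by z is an embedding. *)
Definition contains_group_ring : Prop := injective group_ring_val.

Definition ZP : set F := range group_ring_val.

Definition ZPplus : set F :=
  range (fun p : {mpoly int[m]} => mpoly.mmap intr z p).

(* Allowing b = 0 is harmless: a / 0 = 0. *)
Definition frac_ZP : set F := [set a / b | a in ZP & b in ZP].

Definition subring_gen (G : set F) : set F :=
  smallest (fun A : set F => GRing.subring_closed (mem A)) G.

Definition subfield_gen (G : set F) : set F :=
  smallest (fun A : set F => GRing.divring_closed (mem A)) G.

Definition alg_independent (K : set F) (x : 'I_n -> F) : Prop :=
  forall p : {mpoly F[n]}, p \is a mpolyOver n (mem K) -> p.@[x] = 0 -> p = 0.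

Definition freely_generates (K : set F) (x : 'I_n -> F) : Prop :=
  alg_independent K x /\ subfield_gen (K `|` range x) = [set: F].

Definition skew_symmetrizable (B : 'M[int]_n) : Prop :=
  exists d : 'I_n -> int,
    (forall i, 0 < d i) /\ (forall i j, d i * B i j = - (d j * B j i)).

Record seed_data := SeedData {
  exchange_matrix : 'M[int]_n;
  cluster : {ffun 'I_n -> F};
  coefficients : {ffun 'I_n -> trop m}
}.

Definition is_seed (S : seed_data) : Prop :=
  skew_symmetrizable (exchange_matrix S) /\
  freely_generates frac_ZP (cluster S).

Definition pos_part (a : int) : int := Num.max a 0.

(* The division by 2 is exact. *)
Definition mutate_matrix (k : 'I_n) (B : 'M[int]_n) : 'M[int]_n :=
  \matrix_(i, j)
    if (i == k) || (j == k) then - B i j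
    else B i j + ((`|B i k| * B k j + B i k * `|B k j|) %/ 2)%Z.

Definition mutate_cluster (k : 'I_n) (S : seed_data) : {ffun 'I_n -> F} :=
  let B := exchange_matrix S in
  let x := cluster S in
  let y := coefficients S in
  [ffun i =>
    if i == k then
      (trop_val (y k) * \prod_(j < n) x j ^ pos_part (B j k)
         + \prod_(j < n) x j ^ pos_part (- B j k))
        / (trop_val (trop_oplus (y k) 0) * x k)
    else x i].

Definition mutate_coefficients (k : 'I_n) (B : 'M[int]_n)
    (y : {ffun 'I_n -> trop m}) : {ffun 'I_n -> trop m} :=
  [ffun i =>
    if i == k then - y k
    else y i + y k *~ pos_part (B k i) + trop_oplus (y k) 0 *~ (- B k i)].

Definition mutate (S : seed_data) (k : 'I_n) : seed_data :=
  SeedData (mutate_matrix k (exchange_matrix S))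
           (mutate_cluster k S)
           (mutate_coefficients k (exchange_matrix S) (coefficients S)).

Definition permute_seed (s : 'S_n) (S : seed_data) : seed_data :=
  SeedData (\matrix_(i, j) exchange_matrix S (s i) (s j))
           [ffun i => cluster S (s i)]
           [ffun i => coefficients S (s i)].

Definition mutation_equivalent (S S' : seed_data) : Prop :=
  exists (ks : seq 'I_n) (s : 'S_n), S' = permute_seed s (foldl mutate S ks).

Definition cluster_variables (S : seed_data) : set F :=
  [set f | exists S', mutation_equivalent S S' /\ range (cluster S') f].

(* A is the ground ring. *)
Definition cluster_algebra (A : set F) (S : seed_data) : set F :=
  subring_gen (A `|` cluster_variables S).

Definition laurent_ring (A : set F) (x : 'I_n -> F) : set F :=
  subring_gen (A `|` range x `|` range (fun i => (x i)^-1)).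

Definition upper_cluster_algebra (A : set F) (S : seed_data) : set F :=
  \bigcap_(S' in [set S' | mutation_equivalent S S'])
     laurent_ring A (cluster S').

End Seeds.

(* inl i is the mutable vertex i and inr j the frozen vertex z_j;
   arrows v w is the number of arrows from v to w. *)
Record quiver (n m : nat) := Quiver {
  arrows : 'I_n + 'I_m -> 'I_n + 'I_m -> nat;
  quiver_no_loop : forall v, arrows v v = 0%N;
  quiver_no_2cycle : forall v w, arrows v w = 0%N \/ arrows w v = 0%N;
  quiver_no_frozen : forall i j : 'I_m, arrows (inr i) (inr j) = 0%N
}.

Section Quivers.

Variables (n m : nat) (Q : quiver n m).

Definition is_frozen (v : 'I_n + 'I_m) : bool :=
  if v is inr _ then true else false.

(* The entry (j, i) counts the arrows i -> j. *)
Definition quiver_matrix : 'M[int]_n :=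
  \matrix_(j, i) ((arrows Q (inl i) (inl j))%:Z - (arrows Q (inl j) (inl i))%:Z).

Definition quiver_coefficients : {ffun 'I_n -> trop m} :=
  [ffun i => [ffun j =>
    (arrows Q (inl i) (inr j))%:Z - (arrows Q (inr j) (inl i))%:Z]].

Definition quiver_seed (F : fieldType) (x : {ffun 'I_n -> F}) :
    seed_data F n m :=
  SeedData quiver_matrix x quiver_coefficients.

Definition acyclic : Prop :=
  forall c : seq 'I_n,
    path.cycle (fun i j => (0 < arrows Q (inl i) (inl j))%N) c -> c = [::].

Definition source_freezing : Prop :=
  forall v w, (0 < arrows Q v w)%N -> is_frozen v || is_frozen w ->
    ~~ is_frozen v && is_frozen w.

Lemma quiver_seedP (F : fieldType) (z : 'I_m -> F) (x : {ffun 'I_n -> F}) :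
  is_seed z (quiver_seed x) <-> freely_generates (frac_ZP z) x.
Proof.
split=> [[] //|gen_x]; split=> //=.
by exists (fun=> 1); split=> // i j; rewrite !mxE !mul1r opprB.
Qed.

End Quivers.

(* Main.v *)
From HB Require Import structures.
Require Import Defs.
From mathcomp Require Import all_boot all_order all_fingroup all_algebra.
From mathcomp Require Import boolp classical_sets.
From mathcomp Require Import mpoly.
From mathcomp Require monalg.
From mathcomp Require Import ring zify.

Set Implicit Arguments.
Unset Strict Implicit.
Unset Printing Implicit Defensive.

Import Order.TTheory GRing.Theory Num.Theory.
Local Open Scope classical_set_scope.
Local Open Scope ring_scope.

(** Both inclusions compare expansions in one variable at a time. If [x] is
    transcendental over a ring [E] and [x * x' = P] lies in [E], an element which
    is a Laurent polynomial over [E] both in [x] and in [x'] is a polynomial in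
    [x] and [x'] ([laurent_exchange]). Throughout, the frozen variables are put on
    the same footing as the cluster variables: a seed becomes a skew-symmetric
    matrix on all the vertices together with an algebraically independent family
    ([gseed], [represents]), and a frozen vertex is one at which no mutation is
    made.

    The cluster algebra lies in the upper one by the Laurent phenomenon. It is
    proved by induction on the length of a sequence of mutations
    ([laurent_phenomenon]). For a sequence starting with directions [i], [j], the
    last variable is a Laurent polynomial in the cluster reached after these two
    steps and in the two clusters adjacent to it in directions [i] and [j]; it has
    to be shown to be a polynomial in the variables of [i] and [j] and their
    neighbours, because rank two computations carry that ring back to the initial
    cluster ([two_mutable_laurent]). If [i] and [j] are joined, this holds because
    their variables generate the unit ideal ([two_mutable_edge]). If not, it holds
    when the two exchange polynomials are coprime ([two_mutable_square]), and may
    fail otherwise; coprimality is forced by attaching to [i] a new vertex with a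
    new variable [w], and the result is recovered by setting [w] to 1.

    The same device shows that a vertex [o] without mutations contributes no
    negative power ([laurent_frozen]): attach to it a vertex with variable [w],
    so that mutation at [o] replaces its variable [z] by [(A w + C) / z] with
    monomials [A] and [C]. The element is a polynomial in these two, and setting
    [w] to [- C / A] annihilates the second. This gives the Laurent phenomenon
    over the polynomial ground ring.

    Conversely, let [f] be in the upper cluster algebra. It is shown, for each set
    [T] of mutable vertices, that [f] is a polynomial in all the variables, the
    inverses of those of mutable vertices outside [T], and the neighbours of those
    of [T] ([mixed_ring_source]); the case of all mutable vertices is the theorem.
    If [T] has no arrows, the mutations in [T] commute, and [laurent_exchange]
    applies to the vertices of [T] in turn ([isolated_mixed_ring]); using all the
    resulting clusters, and not only the adjacent ones, dispenses with coprimality.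
    Otherwise acyclicity provides a source [i] of [T] with an arrow to some [j] in
    [T]. As all the arrows at frozen vertices point towards them, the exchange
    relation at [i] expresses a unit as a combination of the variables of [i] and
    [j], while by induction some power of each of these two variables multiplies
    [f] into the required ring. *)

(** * Subrings of a field *)

Section Subrings.

Variable F : fieldType.
Implicit Types (E G H : set F) (x y f : F).

Definition is_subring E : Prop := GRing.subring_closed (mem E).

Lemma is_subringP E :
  [/\ E 1, forall x y, E x -> E y -> E (x - y)
         & forall x y, E x -> E y -> E (x * y)] -> is_subring E.
Proof.
move=> [E1 EB EM]; split; first by rewrite inE.
- by move=> x y; rewrite !inE; apply: EB.
- by move=> x y; rewrite !inE; apply: EM.
Qed.

Section Closure.

Variable E : set F.
Hypothesis sE : is_subring E.

Lemma subring1 : E 1.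
Proof. by case: sE => + _ _; rewrite inE. Qed.

Lemma subringB x y : E x -> E y -> E (x - y).
Proof. by case: sE => _ h _ ex ey; have := h x y; rewrite !inE; apply. Qed.

Lemma subringM x y : E x -> E y -> E (x * y).
Proof. by case: sE => _ _ h ex ey; have := h x y; rewrite !inE; apply. Qed.

Lemma subring0 : E 0.
Proof. by rewrite -(subrr 1); apply: subringB; apply: subring1. Qed.

Lemma subringN x : E x -> E (- x).
Proof. by rewrite -sub0r; apply: subringB; apply: subring0. Qed.

Lemma subringD x y : E x -> E y -> E (x + y).
Proof. by move=> ex ey; rewrite -[y]opprK; apply: subringB => //; apply: subringN. Qed.

Lemma subringX x n : E x -> E (x ^+ n).
Proof.
move=> ex; elim: n => [|n IHn]; first exact: subring1.
by rewrite exprS; apply: subringM.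
Qed.

Lemma subring_sum (I : Type) (r : seq I) (P : pred I) (f : I -> F) :
  (forall i, P i -> E (f i)) -> E (\sum_(i <- r | P i) f i).
Proof. by move=> Ef; apply: big_ind Ef; [apply: subring0|apply: subringD]. Qed.

Lemma subring_prod (I : Type) (r : seq I) (P : pred I) (f : I -> F) :
  (forall i, P i -> E (f i)) -> E (\prod_(i <- r | P i) f i).
Proof. by move=> Ef; apply: big_ind Ef; [apply: subring1|apply: subringM]. Qed.

Lemma subring_horner (p : {poly F}) x :
  (forall i, E p`_i) -> E x -> E p.[x].
Proof.
move=> Ep Ex; rewrite horner_coef; apply: subring_sum => i _.
by apply: subringM => //; apply: subringX.
Qed.

Lemma subring_coefM (p q : {poly F}) i :
  (forall i, E p`_i) -> (forall i, E q`_i) -> E (p * q)`_i.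
Proof.
move=> Ep Eq; rewrite coefM; apply: subring_sum => j _; exact: subringM.
Qed.

End Closure.

Lemma subring_gen_is_subring G : is_subring (subring_gen G).
Proof.
apply: is_subringP; split=> [|x y gx gy|x y gx gy] A [sA GA].
- exact: subring1.
- by apply: subringB => //; [apply: gx|apply: gy].
- by apply: subringM => //; [apply: gx|apply: gy].
Qed.
#[local] Hint Resolve subring_gen_is_subring : core.

Lemma mem_subring_gen G x : G x -> subring_gen G x.
Proof. by move=> Gx A [_]; apply. Qed.

Lemma subring_gen_sub G E :
  is_subring E -> (forall x, G x -> E x) -> forall x, subring_gen G x -> E x.
Proof. by move=> sE GE x; apply; split. Qed.

Lemma subring_genS G H x :
  (forall y, G y -> subring_gen H y) -> subring_gen G x -> subring_gen H x.
Proof. by move=> GH; apply: subring_gen_sub. Qed.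

Definition adjoin G (xs : seq F) : set F := subring_gen (G `|` [set` xs]).

Lemma adjoin_is_subring G xs : is_subring (adjoin G xs).
Proof. exact: subring_gen_is_subring. Qed.

Lemma adjoin_sub G xs E : is_subring E ->
  (forall x, G x -> E x) -> (forall x, x \in xs -> E x) ->
  forall x, adjoin G xs x -> E x.
Proof. by move=> sE GE xsE; apply: subring_gen_sub => // x [/GE|/xsE]. Qed.

Lemma adjoin_base G xs x : G x -> adjoin G xs x.
Proof. by move=> Gx; apply: mem_subring_gen; left. Qed.

Lemma adjoin_mem G xs x : x \in xs -> adjoin G xs x.
Proof. by move=> xsx; apply: mem_subring_gen; right. Qed.

Lemma adjoin_gen G xs x : subring_gen G x -> adjoin G xs x.
Proof. by apply: subring_genS => y Gy; apply: adjoin_base. Qed.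

Lemma adjoin1P E x f : is_subring E -> adjoin E [:: x] f ->
  exists2 p : {poly F}, (forall i, E p`_i) & f = p.[x].
Proof.
move=> sE; pose A := [set f | exists2 p : {poly F}, (forall i, E p`_i) & f = p.[x]].
apply: (@adjoin_sub _ _ A); first (apply: is_subringP; split).
- exists 1; last by rewrite hornerC.
  by move=> i; rewrite coef1; case: (_ == _); [apply: subring1|apply: subring0].
- move=> _ _ [p Ep ->] [q Eq ->]; exists (p - q); last by rewrite hornerD hornerN.
  by move=> i; rewrite coefB; apply: subringB.
- move=> _ _ [p Ep ->] [q Eq ->]; exists (p * q); last by rewrite hornerM.
  by move=> i; apply: subring_coefM.
- move=> y Ey; exists y%:P; last by rewrite hornerC.
  by move=> i; rewrite coefC; case: (_ == _) => //; apply: subring0.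
- move=> y; rewrite inE => /eqP ->; exists 'X; last by rewrite hornerX.
  by move=> i; rewrite coefX; case: (_ == _); [apply: subring1|apply: subring0].
Qed.

(** Denominators which are powers of [x] can be cleared one element at a time:
    the elements that some power of [x] moves into [A] form a subring. *)
Lemma adjoinV_clear A x f : is_subring A -> A x -> x != 0 ->
  adjoin A [:: x; x^-1] f -> exists N, A (f * x ^+ N).
Proof.
move=> sA Ax x0; pose B := [set f | exists N, A (f * x ^+ N)].
have AX N : A (x ^+ N) by apply: subringX.
apply: (@adjoin_sub _ _ B); first (apply: is_subringP; split).
- by exists 0%N; rewrite mulr1; apply: subring1.
- move=> a b [N aN] [M bM]; exists (N + M)%N.
  have -> : (a - b) * x ^+ (N + M) = a * x ^+ N * x ^+ M - b * x ^+ M * x ^+ N.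
    by rewrite exprD; ring.
  by apply: subringB => //; apply: subringM.
- move=> a b [N aN] [M bM]; exists (N + M)%N.
  have -> : a * b * x ^+ (N + M) = a * x ^+ N * (b * x ^+ M).
    by rewrite exprD; ring.
  exact: subringM.
- by move=> y Ay; exists 0%N; rewrite mulr1.
- move=> y; rewrite !inE => /orP[] /eqP ->; first by exists 0%N; rewrite mulr1.
  by exists 1%N; rewrite expr1 mulVf //; apply: subring1.
Qed.

Lemma adjoinVP E x f : is_subring E -> x != 0 -> adjoin E [:: x; x^-1] f ->
  exists N, exists2 p : {poly F}, (forall i, E p`_i) & f * x ^+ N = p.[x].
Proof.
move=> sE x0 Ef.
have sA := adjoin_is_subring E [:: x].
have Ax : adjoin E [:: x] x by apply: adjoin_mem; rewrite inE.
have /(adjoinV_clear sA Ax x0)[N /(adjoin1P sE)[p Ep fN]] :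
    adjoin (adjoin E [:: x]) [:: x; x^-1] f.
  apply: adjoin_sub Ef; first exact: adjoin_is_subring.
    by move=> y Ey; do 2 apply: adjoin_base.
  by move=> y y_x; apply: adjoin_mem.
by exists N, p.
Qed.

(** Membership in [A] is local. All the multiples of [f] by monomials in [x] and
    [y] of degree [N + M] are in [A], and the relation [a * x + b * y = 1] lowers
    the degree one step at a time. *)
Lemma unit_ideal_clear A x y a b f N M : is_subring A ->
  A x -> A y -> A a -> A b -> a * x + b * y = 1 ->
  A (f * x ^+ N) -> A (f * y ^+ M) -> A f.
Proof.
move=> sA Ax Ay Aa Ab ab fN fM.
have all s i j : (i + j + s = N + M)%N -> A (f * x ^+ i * y ^+ j).
  elim: s i j => [|s IHs] i j ij.
    have [leNi|ltiN] := leqP N i.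
      rewrite -(subnKC leNi) exprD mulrA; apply: subringM => //.
        by apply: subringM => //; apply: subringX.
      exact: subringX.
    have leMj : (M <= j)%N by lia.
    rewrite -(subnKC leMj) exprD.
    have -> : f * x ^+ i * (y ^+ M * y ^+ (j - M))
            = f * y ^+ M * (x ^+ i * y ^+ (j - M)) by ring.
    by apply: subringM => //; apply: subringM => //; apply: subringX.
  have -> : f * x ^+ i * y ^+ j
    = a * (f * x ^+ i.+1 * y ^+ j) + b * (f * x ^+ i * y ^+ j.+1).
    by rewrite -[LHS]mulr1 -ab !exprS; ring.
  by apply: subringD => //; apply: subringM => //; apply: IHs; lia.
by have := all (N + M)%N 0%N 0%N; rewrite !expr0 !mulr1; apply; lia.
Qed.

(** ** Transcendental elements *)

Definition transcendental E x : Prop :=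
  forall p : {poly F}, (forall i, E p`_i) -> p.[x] = 0 -> p = 0.

Lemma transcendentalS E H x : (forall y, H y -> E y) ->
  transcendental E x -> transcendental H x.
Proof. by move=> HE tx p Hp; apply: tx => i; apply: HE. Qed.

Lemma transcendental_inj E x (p q : {poly F}) : is_subring E ->
  transcendental E x -> (forall i, E p`_i) -> (forall i, E q`_i) ->
  p.[x] = q.[x] -> p = q.
Proof.
move=> sE tx Ep Eq pq; apply/eqP; rewrite -subr_eq0; apply/eqP; apply: tx.
  by move=> i; rewrite coefB; apply: subringB.
by rewrite hornerD hornerN pq subrr.
Qed.

Lemma transcendental_neq0 E x : is_subring E -> transcendental E x -> x != 0.
Proof.
move=> sE tx; apply/eqP => x0; suff /eqP : 'X = 0 :> {poly F} by rewrite polyX_eq0.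
apply: tx => [i|]; last by rewrite hornerX.
by rewrite coefX; case: (_ == _); [apply: subring1|apply: subring0].
Qed.

(** An algebraic relation of [a] over [G] and [b] is a polynomial in both; read as
    a polynomial in [b], it has coefficients in [G] and [a]. Independence of a
    family is thereby preserved by mutations and by adding a variable. *)
Lemma transcendental_exchange G a b :
  transcendental (subring_gen G) a -> transcendental (adjoin G [:: a]) b ->
  transcendental (adjoin G [:: b]) a.
Proof.
move=> ta tb p Ep pa0.
have sG := subring_gen_is_subring G.
have sGa := adjoin_is_subring G [:: a].
have /choice[q qP] (i : nat) : exists q : {poly F},
    (forall j, subring_gen G q`_j) /\ p`_i = q.[b].
  have [|q Eq pq] := @adjoin1P (subring_gen G) b p`_i sG; last by exists q.
  apply: adjoin_sub (Ep i); first exact: adjoin_is_subring.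
    by move=> y Gy; apply: adjoin_base; apply: mem_subring_gen.
  by move=> y y_b; apply: adjoin_mem.
have q0 i j : (i < size p)%N -> (q i)`_j = 0.
  move=> lti.
  have s0 : \sum_(k < size p) a ^+ k *: q k = 0.
    apply: tb.
      move=> l; rewrite coef_sum; apply: (subring_sum sGa) => k _.
      rewrite coefZ; apply: (subringM sGa).
        by apply: (subringX sGa); apply: adjoin_mem; rewrite inE.
      by apply: adjoin_gen; case: (qP k).
    rewrite -pa0 horner_sum (horner_coef p); apply: eq_bigr => k _.
    by rewrite hornerZ mulrC; case: (qP k) => _ ->.
  have /(congr1 (fun r : {poly F} => r`_i)) : \poly_(k < size p) (q k)`_j = 0.
    apply: ta.
      move=> k; rewrite coef_poly; case: ifP => _; last exact: subring0.
      by case: (qP k).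
    rewrite horner_poly; have := congr1 (fun r : {poly F} => r`_j) s0.
    rewrite coef_sum coef0 => s0j; rewrite -[RHS]s0j; apply: eq_bigr => k _.
    by rewrite coefZ mulrC.
  by rewrite coef_poly lti coef0.
apply/polyP => i; rewrite coef0; have [lti|] := ltnP i (size p); last first.
  exact: nth_default.
case: (qP i) => _ ->; suff -> : q i = 0 by rewrite horner0.
by apply/polyP => j; rewrite coef0 q0.
Qed.

(** The fraction field of [E] inside [F]. *)
Definition fractions E : set F :=
  [set f | exists d, [/\ E d, d != 0 & E (d * f)]].

Lemma fractions_is_subring E : is_subring E -> is_subring (fractions E).
Proof.
move=> sE; apply: is_subringP; split.
- by exists 1; split; rewrite ?oner_neq0 ?mulr1 //; apply: subring1.
- move=> a b [c [Ec c0 Eca]] [d [Ed d0 Edb]]; exists (c * d); split.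
  + exact: subringM.
  + by rewrite mulf_neq0.
  + have -> : c * d * (a - b) = d * (c * a) - c * (d * b) by ring.
    by apply: subringB => //; apply: subringM.
- move=> a b [c [Ec c0 Eca]] [d [Ed d0 Edb]]; exists (c * d); split.
  + exact: subringM.
  + by rewrite mulf_neq0.
  + have -> : c * d * (a * b) = (c * a) * (d * b) by ring.
    exact: subringM.
Qed.

Lemma fractionsV E f : is_subring E -> fractions E f -> fractions E f^-1.
Proof.
move=> sE [d [Ed d0 Edf]]; have [->|f0] := eqVneq f 0.
  by rewrite invr0; apply: subring0; apply: fractions_is_subring.
exists (d * f); split=> //; first by rewrite mulf_neq0.
by rewrite mulfK.
Qed.

Lemma sub_fractions E f : is_subring E -> E f -> fractions E f.
Proof.
by move=> sE Ef; exists 1; rewrite oner_neq0 mul1r; split=> //; apply: subring1.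
Qed.

Lemma transcendental_fractions E x : is_subring E ->
  transcendental E x -> transcendental (fractions E) x.
Proof.
move=> sE tx p Ep px0.
have [d [d0 Edp]] : exists d, d != 0 /\ forall i, E (d * p`_i).
  have [d [Ed d0 dP]] : exists d, [/\ E d, d != 0 &
      forall i, (i < size p)%N -> E (d * p`_i)].
    elim: (size p) => [|n [d [Ed d0 dP]]].
      by exists 1; rewrite oner_neq0; split=> //; apply: subring1.
    have [c [Ec c0 Ecp]] := Ep n; exists (c * d); split.
    - exact: subringM.
    - by rewrite mulf_neq0.
    - move=> i; rewrite ltnS leq_eqVlt => /orP[/eqP ->|lti].
        by rewrite mulrAC; apply: subringM.
      by rewrite -mulrA; apply: subringM => //; apply: dP.
  exists d; split=> // i; have [/dP//|lei] := ltnP i (size p).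
  by rewrite nth_default // mulr0; apply: subring0.
have /eqP : d *: p = 0.
  by apply: tx => [i|]; rewrite ?coefZ // hornerZ px0 mulr0.
by rewrite scaler_eq0 (negbTE d0) => /eqP.
Qed.

Lemma transcendental_div E x c : is_subring E -> transcendental E x ->
  E c -> c != 0 -> transcendental E (c / x).
Proof.
move=> sE tx Ec c0 p Ep pcx0.
have x0 := transcendental_neq0 sE tx.
set n := size p.
pose q := \poly_(i < n) (p`_(n.-1 - i) * c ^+ (n.-1 - i)).
have q0 : q = 0.
  apply: tx.
    move=> i; rewrite coef_poly; case: ifP => _; last exact: subring0.
    by apply: subringM => //; apply: subringX.
  have <- : x ^+ n.-1 * p.[c / x] = 0 by rewrite pcx0 mulr0.
  rewrite horner_poly horner_coef mulr_sumr (reindex_inj rev_ord_inj) /=.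
  apply: eq_bigr => i _.
  have -> : (n.-1 - (n - i.+1))%N = i by have := ltn_ord i; lia.
  have -> : (n - i.+1 = n.-1 - i)%N by lia.
  have lei : (i <= n.-1)%N by have := ltn_ord i; lia.
  rewrite expr_div_n -{2}(subnK lei) exprD.
  have xi0 : x ^+ i != 0 by rewrite expf_neq0.
  by field.
apply/polyP => i; rewrite coef0; have [lti|] := ltnP i n; last exact: nth_default.
have := congr1 (fun r : {poly F} => r`_(n.-1 - i)) q0.
rewrite coef_poly coef0 ifT; last by lia.
have -> : (n.-1 - (n.-1 - i))%N = i by lia.
by move/eqP; rewrite mulf_eq0 expf_eq0 (negbTE c0) andbF orbF => /eqP.
Qed.

(** ** Laurent polynomials in one variable *)

(** Comparing the two expansions of [f], the coefficient of [x ^- a] in the first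
    one is divisible by [P ^ a] in [E'], hence in [E], and the corresponding term
    is a multiple of [(P / x) ^ a]. The ring [E'] is larger than [E] when [f] has
    fewer denominators in the first expansion than in the second one. *)
Lemma laurent_exchange E E' x P f : is_subring E -> is_subring E' ->
  (forall y, E y -> E' y) -> transcendental E' x -> E P -> P != 0 ->
  (forall e c, E e -> E' (e / P ^+ c) -> E (e / P ^+ c)) ->
  adjoin E [:: x; x^-1] f -> adjoin E' [:: P / x; (P / x)^-1] f ->
  adjoin E [:: x; P / x] f.
Proof.
move=> sE sE' EE' tx EP P0 EP' fx fx'.
have x0 := transcendental_neq0 sE' tx.
have x'0 : P / x != 0 by rewrite mulf_neq0 ?invr_eq0.
have [N [p Ep fp]] := adjoinVP sE x0 fx.
have [M [q Eq fq]] := adjoinVP sE' x'0 fx'.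
set D := size q.
(* the two expansions of [f], multiplied by [P ^ M * x ^ (N + D)], where [D]
   is large enough to clear the negative powers of [x] in the second one *)
have pq : P ^+ M *: (p * 'X^D)
        = \sum_(b < D) (q`_b * P ^+ b) *: 'X^(M + N + (D - b)).
  apply: (transcendental_inj sE' tx).
  - move=> i; rewrite coefZ coefMXn; case: ifP => _.
      by rewrite mulr0; apply: subring0.
    by apply: subringM => //; [apply: subringX => //|]; apply: EE'.
  - move=> i; rewrite coef_sum; apply: subring_sum => // b _.
    rewrite coefZ coefXn; apply: subringM => //.
      by apply: subringM => //; apply: subringX => //; apply: EE'.
    by case: (_ == _); [apply: subring1|apply: subring0].
  rewrite hornerZ hornerM hornerXn -fp horner_sum.
  have -> : P ^+ M * (f * x ^+ N * x ^+ D) = q.[P / x] * x ^+ (M + N + D).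
    rewrite -fq expr_div_n !exprD; have xM : x ^+ M != 0 by rewrite expf_neq0.
    by field.
  rewrite horner_coef mulr_suml; apply: eq_bigr => b _.
  rewrite hornerZ hornerXn expr_div_n.
  have -> : (M + N + D)%N = (b + (M + N + (D - b)))%N by have := ltn_ord b; lia.
  rewrite exprD; have xb : x ^+ b != 0 by rewrite expf_neq0.
  by field.
have divp a : (a < N)%N -> E (p`_a / P ^+ (N - a)).
  move=> ltaN; apply: EP' => //.
  have := congr1 (fun r : {poly F} => r`_(a + D)) pq.
  rewrite coefZ coefMXn ifF; last by lia.
  rewrite addnK coef_sum => pqa.
  have -> : p`_a / P ^+ (N - a) = if (M + N - a < D)%N then q`_(M + N - a) else 0.
    have PM : P ^+ M != 0 by rewrite expf_neq0.
    have PNa : P ^+ (N - a) != 0 by rewrite expf_neq0.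
    apply: (mulIf PNa); rewrite divfK //; apply: (mulfI PM); rewrite pqa.
    case: ifP => [ltD|/negbT leD].
      rewrite (bigD1 (Ordinal ltD)) //= big1 ?addr0.
        rewrite coefZ coefXn (_ : (_ == _) = true); last by apply/eqP; lia.
        rewrite mulr1 -[X in P ^+ X](_ : M + (N - a) = _)%N; last by lia.
        by rewrite exprD; ring.
      move=> b /eqP neb; rewrite coefZ coefXn.
      case: eqP => [eqb|]; last by rewrite mulr0.
      by case: neb; apply: val_inj => /=; have := ltn_ord b; lia.
    rewrite mul0r mulr0 big1 // => b _; rewrite coefZ coefXn.
    by case: eqP => [eqb|]; rewrite ?mulr0 //; have := ltn_ord b; lia.
  by case: ifP => _ //; apply: subring0.
have -> : f = \sum_(a < size p)
    if (a < N)%N then p`_a / P ^+ (N - a) * (P / x) ^+ (N - a)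
    else p`_a * x ^+ (a - N).
  have xN : x ^+ N != 0 by rewrite expf_neq0.
  apply: (mulIf xN); rewrite fp horner_coef mulr_suml; apply: eq_bigr => a _.
  case: ltnP => [ltaN|leNa]; last by rewrite -mulrA -exprD subnK.
  have PNa : P ^+ (N - a) != 0 by rewrite expf_neq0.
  have xNa : x ^+ (N - a) != 0 by rewrite expf_neq0.
  rewrite expr_div_n -[X in x ^+ X](subnK (ltnW ltaN)) exprD.
  by field; rewrite xNa PNa.
have sA := adjoin_is_subring E [:: x; P / x].
apply: (subring_sum sA) => // a _; case: ifP => [ltaN|_].
  apply: (subringM sA) => //; first by apply: adjoin_base; apply: divp.
  by apply: (subringX sA) => //; apply: adjoin_mem; rewrite !inE eqxx orbT.
apply: (subringM sA) => //; first exact: adjoin_base.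
by apply: (subringX sA) => //; apply: adjoin_mem; rewrite !inE eqxx.
Qed.

(** The expansion in powers of a transcendental element is unique. *)
Lemma laurent_polynomial E E' x f : is_subring E -> is_subring E' ->
  (forall y, E y -> E' y) -> transcendental E' x ->
  adjoin E [:: x; x^-1] f -> adjoin E' [:: x] f -> adjoin E [:: x] f.
Proof.
move=> sE sE' EE' tx fx fx'.
have x0 := transcendental_neq0 sE' tx.
have [N [p Ep fp]] := adjoinVP sE x0 fx.
have [q Eq fq] := adjoin1P sE' fx'.
have pq : p = q * 'X^N.
  apply: (transcendental_inj sE' tx) => [i|i|]; first exact: EE'.
    by rewrite coefMXn; case: ifP => _ //; apply: subring0.
  by rewrite -fp fq hornerM hornerXn.
rewrite fq; apply: (subring_horner (adjoin_is_subring _ _)).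
  move=> i; apply: adjoin_base.
  by have := Ep (i + N)%N; rewrite pq coefMXn ifF ?addnK //; lia.
by apply: adjoin_mem; rewrite inE.
Qed.

End Subrings.

#[local] Hint Resolve subring_gen_is_subring adjoin_is_subring : core.

(** * Adding a variable to the field, and specialising it *)

Definition ratfun (F : fieldType) : fieldType := {fraction {poly F}}.

Section Specialisation.

Variable F : fieldType.
Implicit Types (x y c : F) (p q : {poly F}).

Local Notation Fw := (ratfun F).
Local Definition frac : {poly F} -> Fw := @FracField.tofrac {poly F}.
HB.instance Definition _ := GRing.RMorphism.on frac.
Local Notation "p %:F" := (frac p).

Lemma frac_eq0 p : (p%:F == 0) = (p == 0).
Proof. exact: tofrac_eq0. Qed.

Lemma frac_eq p q : (p%:F == q%:F) = (p == q).
Proof. exact: tofrac_eq. Qed.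

Lemma fracB : {morph frac : p q / p - q}.
Proof. exact: rmorphB. Qed.

Lemma fracM : {morph frac : p q / p * q}.
Proof. exact: rmorphM. Qed.

Lemma frac1 : 1%:F = 1.
Proof. exact: rmorph1. Qed.

Definition cst : F -> Fw := frac \o polyC.
HB.instance Definition _ := GRing.RMorphism.on cst.
Definition var : Fw := 'X%:F.

Lemma horner_cst p : (map_poly cst p).[var] = p%:F.
Proof.
rewrite (map_poly_comp frac polyC) /var horner_map /=.
by rewrite -/(comp_poly 'X p) comp_polyXr.
Qed.

Lemma cst_lift_poly (E : set F) (p : {poly Fw}) : is_subring E ->
  (forall i, (cst @` E) p`_i) ->
  exists2 q : {poly F}, (forall i, E q`_i) & p = map_poly cst q.
Proof.
move=> sE Ep; have /choice[g gP] i : exists x, E x /\ cst x = p`_i.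
  by have [x Ex xp] := Ep i; exists x.
exists (\poly_(i < size p) g i).
  move=> i; rewrite coef_poly; case: ifP => _; last exact: subring0.
  by case: (gP i).
apply/polyP => i; rewrite coef_map coef_poly; case: ltnP => [_|lei].
  by case: (gP i).
by rewrite raddf0 nth_default.
Qed.

Lemma image_cst_is_subring (E : set F) : is_subring E -> is_subring (cst @` E).
Proof.
move=> sE; apply: is_subringP; split.
- by exists 1; rewrite ?rmorph1 //; apply: subring1.
- move=> _ _ [x Ex <-] [y Ey <-]; exists (x - y); rewrite ?rmorphB //.
  exact: subringB.
- move=> _ _ [x Ex <-] [y Ey <-]; exists (x * y); rewrite ?rmorphM //.
  exact: subringM.
Qed.

Lemma transcendental_var : transcendental (range cst) var.
Proof.
move=> p Ep; have sT : is_subring [set: F] by apply: is_subringP.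
have [q _ ->] := cst_lift_poly sT Ep.
rewrite horner_cst => /eqP; rewrite frac_eq0 => /eqP ->.
by rewrite map_poly0.
Qed.

Lemma transcendental_cst (E : set F) x : is_subring E ->
  transcendental E x -> transcendental (cst @` E) (cst x).
Proof.
move=> sE tx p Ep; have [q Eq ->] := cst_lift_poly sE Ep.
by rewrite horner_map => /eqP; rewrite fmorph_eq0 => /eqP /tx -> //; rewrite map_poly0.
Qed.

(** A relation and not a function, since [f] may have a pole at [c]. *)
Definition specialises c (f : Fw) (g : F) : Prop :=
  exists p q, [/\ q.[c] != 0, f * q%:F = p%:F & g * q.[c] = p.[c]].

Lemma specialises_cst c x : specialises c (cst x) x.
Proof.
by exists x%:P, 1; rewrite !hornerC frac1 oner_neq0 !mulr1.
Qed.

Lemma specialises_var c : specialises c var c.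
Proof. by exists 'X, 1; rewrite hornerX hornerC frac1 oner_neq0 !mulr1. Qed.

Lemma specialisesB c f f' g g' : specialises c f g -> specialises c f' g' ->
  specialises c (f - f') (g - g').
Proof.
move=> [p [q [q0 fq gq]]] [p' [q' [q'0 fq' gq']]].
exists (p * q' - p' * q), (q * q'); split.
- by rewrite hornerM mulf_neq0.
- by rewrite fracB !fracM -fq -fq'; ring.
- by rewrite hornerD hornerN !hornerM -gq -gq'; ring.
Qed.

Lemma specialisesM c f f' g g' : specialises c f g -> specialises c f' g' ->
  specialises c (f * f') (g * g').
Proof.
move=> [p [q [q0 fq gq]]] [p' [q' [q'0 fq' gq']]].
exists (p * p'), (q * q'); split.
- by rewrite hornerM mulf_neq0.
- by rewrite !fracM -fq -fq'; ring.
- by rewrite !hornerM -gq -gq'; ring.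
Qed.

Lemma specialises1 c : specialises c 1 1.
Proof. by rewrite -(rmorph1 cst); apply: specialises_cst. Qed.

Lemma specialises0 c : specialises c 0 0.
Proof. by rewrite -(rmorph0 cst); apply: specialises_cst. Qed.

Lemma specialisesD c f f' g g' : specialises c f g -> specialises c f' g' ->
  specialises c (f + f') (g + g').
Proof.
move=> fg fg'; rewrite -[f']opprK -[g']opprK; apply: specialisesB => //.
by rewrite -sub0r -[- g']sub0r; apply: specialisesB => //; apply: specialises0.
Qed.

Lemma specialisesX c f g n : specialises c f g -> specialises c (f ^+ n) (g ^+ n).
Proof.
move=> fg; elim: n => [|n IHn]; first exact: specialises1.
by rewrite !exprS; apply: specialisesM.
Qed.

Lemma specialises_prod c (I : Type) (r : seq I) (P : pred I)
    (f : I -> Fw) (g : I -> F) : (forall i, P i -> specialises c (f i) (g i)) ->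
  specialises c (\prod_(i <- r | P i) f i) (\prod_(i <- r | P i) g i).
Proof.
move=> fg; apply: (big_rec2 (specialises c)) => [|i x y Pi xy].
  exact: specialises1.
by apply: specialisesM => //; apply: fg.
Qed.

Lemma specialisesV c f g : g != 0 -> specialises c f g -> specialises c f^-1 g^-1.
Proof.
move=> g0 [p [q [q0 fq gq]]]; exists q, p.
have p0 : p.[c] != 0 by rewrite -gq mulf_neq0.
have pF : p%:F != 0.
  by rewrite frac_eq0; apply: contraNneq p0 => ->; rewrite horner0.
have f0 : f != 0 by apply: contraNneq pF => f0; rewrite -fq f0 mul0r.
by split=> //; rewrite -?fq -?gq mulKf.
Qed.

Lemma specialises_div c f f' g g' : g' != 0 -> specialises c f g ->
  specialises c f' g' -> specialises c (f / f') (g / g').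
Proof. by move=> g'0 fg fg'; apply: specialisesM => //; apply: specialisesV. Qed.

Lemma specialises_fun c f g g' : specialises c f g -> specialises c f g' -> g = g'.
Proof.
move=> [p [q [q0 fq gq]]] [p' [q' [q'0 fq' gq']]].
have /eqP : (p * q')%:F = (p' * q)%:F by rewrite !fracM -fq -fq'; ring.
rewrite frac_eq => /eqP /(congr1 (horner^~ c)); rewrite !hornerM -gq -gq'.
have -> : g * q.[c] * q'.[c] = g * (q.[c] * q'.[c]) by ring.
have -> : g' * q'.[c] * q.[c] = g' * (q.[c] * q'.[c]) by ring.
by apply: mulIf; rewrite mulf_neq0.
Qed.

Lemma specialises_gen c (G : set Fw) (H : set F) f :
  (forall a : Fw, G a -> exists2 b, H b & specialises c a b) ->
  subring_gen G f -> exists2 g, subring_gen H g & specialises c f g.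
Proof.
move=> GH; have sH := subring_gen_is_subring H.
pose A := [set f | exists2 g, subring_gen H g & specialises c f g].
apply: (@subring_gen_sub _ G A); first (apply: is_subringP; split).
- by exists 1; [apply: (subring1 sH)|apply: specialises1].
- move=> a a' [b Hb ab] [b' Hb' ab']; exists (b - b'); first exact: (subringB sH).
  exact: specialisesB.
- move=> a a' [b Hb ab] [b' Hb' ab']; exists (b * b'); first exact: (subringM sH).
  exact: specialisesM.
- by move=> a /GH[b Hb ab]; exists b => //; apply: mem_subring_gen.
Qed.

End Specialisation.

(** * Algebraically independent families *)

Section Independence.

Variables (I : finType) (F : fieldType).
Implicit Types (u : I -> F) (i j k : I).

Definition others u i : set F := [set f | exists2 j, j != i & f = u j].

Definition independent u : Prop :=
  forall i, transcendental (subring_gen (others u i)) (u i).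

Lemma independent_neq0 u i : independent u -> u i != 0.
Proof. by move=> iu; apply: transcendental_neq0 (iu i) => //. Qed.

(** [c / u k] is transcendental over the other elements because [u k] is; for
    these, the elements with indices [i] and [k] are exchanged, using that
    [c / u k] is transcendental over everything else together with [u i]. *)
Lemma independent_replace u k c : independent u ->
  subring_gen (others u k) c -> c != 0 ->
  independent (fun i => if i == k then c / u k else u i).
Proof.
move=> iu uc c0 i; pose u' j := if j == k then c / u k else u j.
change (transcendental (subring_gen (others u' i)) (u' i)).
have [->|neik] := eqVneq i k.
  rewrite {2}/u' eqxx; apply: transcendentalS (transcendental_div _ (iu k) uc c0) => //.
  move=> y; apply: subring_genS => _ [j nejk ->]; apply: mem_subring_gen.
  by exists j; rewrite // /u' (negbTE nejk).
pose G : set F := [set f | exists j, [/\ j != i, j != k & f = u j]].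
rewrite {2}/u' (negbTE neik).
apply: (@transcendentalS _ (adjoin G [:: c / u k])).
  move=> y; apply: subring_gen_sub => // _ [j neji ->].
  rewrite /u'; case: (eqVneq j k) => [_|nejk].
    by apply: adjoin_mem; rewrite inE.
  by apply: adjoin_base; exists j.
apply: transcendental_exchange.
  apply: transcendentalS (iu i) => y; apply: subring_genS => _ [j [neji _ ->]].
  by apply: mem_subring_gen; exists j.
apply: transcendentalS (transcendental_div _ (iu k) uc c0) => // y.
apply: adjoin_sub => // [_ [j [_ nejk ->]]|_ /[!inE]/eqP ->].
  by apply: mem_subring_gen; exists j.
by apply: mem_subring_gen; exists i.
Qed.

End Independence.

(** * Mutation of a square matrix together with a family of elements *)

Definition natpos (a : int) : nat := if a is Posz n then n else 0.

Lemma natposE (a : int) : (natpos a)%:Z = Num.max a 0.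
Proof. by case: a => n /=; lia. Qed.

(** The correction of the entries under matrix mutation, which is half of
    [`|a| * b + a * `|b|] (see [half_mutation_term]), in a form which is symmetric
    and visibly integral. *)
Definition mutation_term (a b : int) : int :=
  (natpos a * natpos b)%:Z - (natpos (- a) * natpos (- b))%:Z.

Lemma mutation_termNN a b : mutation_term (- a) (- b) = - mutation_term a b.
Proof. by rewrite /mutation_term !opprK opprB. Qed.

Lemma mutation_termC a b : mutation_term a b = mutation_term b a.
Proof. by rewrite /mutation_term mulnC [(natpos (- a) * _)%N]mulnC. Qed.

(** A seed with its frozen vertices included among the indices: rows and columns
    of [mx] range over all the vertices, and a vertex is frozen when it is never
    mutated. *)
Record gseed (I : finType) (F : fieldType) := GSeed {
  mx : I -> I -> int;
  vr : I -> F
}.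

Section GSeeds.

Variables (I : finType) (F : fieldType).
Implicit Types (S : gseed I F) (i j k : I).

Definition expol S k : F :=
  \prod_a vr S a ^+ natpos (mx S a k) + \prod_a vr S a ^+ natpos (- mx S a k).

Definition gmut S k : gseed I F :=
  GSeed (fun a b => if (a == k) || (b == k) then - mx S a b
                    else mx S a b + mutation_term (mx S a k) (mx S k b))
        (fun a => if a == k then expol S k / vr S k else vr S a).

Definition is_skew S : Prop := forall a b, mx S a b = - mx S b a.

Definition good S : Prop :=
  [/\ is_skew S, independent (vr S) & (2%:R : F) != 0].

Lemma skew_diag S k : is_skew S -> mx S k k = 0.
Proof. by move=> sk; have := sk k k; lia. Qed.

Lemma gen_monomial (G : set F) (P : pred I) (u : I -> F) (e : I -> nat) :
  (forall a, P a -> e a != 0%N -> subring_gen G (u a)) ->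
  subring_gen G (\prod_(a | P a) u a ^+ e a).
Proof.
move=> Gu; apply: (subring_prod (subring_gen_is_subring G)) => a Pa.
have [->|e0] := eqVneq (e a) 0%N.
  by rewrite expr0; apply: (subring1 (subring_gen_is_subring G)).
by apply: (subringX (subring_gen_is_subring G)); apply: Gu.
Qed.

Lemma monomial_neq0 S (P : pred I) (e : I -> nat) : independent (vr S) ->
  \prod_(a | P a) vr S a ^+ e a != 0.
Proof.
move=> iS; rewrite prodf_seq_neq0; apply/allP => a _; apply/implyP => _.
by rewrite expf_neq0 // independent_neq0.
Qed.

Lemma expol_others S k : is_skew S -> subring_gen (others (vr S) k) (expol S k).
Proof.
move=> sk; apply: (subringD (subring_gen_is_subring _)); apply: gen_monomial => a _.
  case: (eqVneq a k) => [->|neak _]; first by rewrite skew_diag.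
  by apply: mem_subring_gen; exists a.
case: (eqVneq a k) => [->|neak _]; first by rewrite skew_diag.
by apply: mem_subring_gen; exists a.
Qed.

(** Only one of the two monomials of [expol S k] involves the variable of [j];
    its positive power is singled out. *)
Lemma expol_split S j k : is_skew S -> mx S j k != 0 ->
  exists b (e1 e2 : I -> nat), [/\ e1 k = 0%N, e2 k = 0%N &
    expol S k = (\prod_(a | a != j) vr S a ^+ e1 a) * vr S j ^+ b.+1
                + \prod_(a | a != j) vr S a ^+ e2 a].
Proof.
move=> sk jk0.
pose e1 a := natpos (mx S a k); pose e2 a := natpos (- mx S a k).
have e1k : e1 k = 0%N by rewrite /e1 skew_diag.
have e2k : e2 k = 0%N by rewrite /e2 skew_diag.
have split (e : I -> nat) : \prod_a vr S a ^+ e a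
    = (\prod_(a | a != j) vr S a ^+ e a) * vr S j ^+ e j.
  by rewrite (bigD1 j) //= mulrC.
rewrite /expol (split e1) (split e2).
have [e1j|e2j] : e1 j = 0%N \/ e2 j = 0%N by rewrite /e1 /e2; case: (mx S j k) => -[]; auto.
  exists (e2 j).-1, e2, e1; split=> //.
  rewrite prednK; last by move: e1j; rewrite /e1 /e2; case: (mx S j k) jk0 => -[].
  by rewrite e1j expr0 mulr1 addrC.
exists (e1 j).-1, e1, e2; split=> //.
rewrite prednK; last by move: e2j; rewrite /e1 /e2; case: (mx S j k) jk0 => -[].
by rewrite e2j expr0 mulr1.
Qed.

(** If some variable occurs, [expol S k] is a nonzero polynomial in it by
    [expol_split]; otherwise it is equal to 2. *)
Lemma expol_neq0 S k : good S -> expol S k != 0.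
Proof.
move=> [sk iS two]; case: (pselect (exists j, mx S j k != 0)) => [[j jk0]|none].
  have [b [e1 [e2 [_ _ ->]]]] := expol_split sk jk0.
  set M1 := \prod_(a | _) _ ^+ e1 a; set M2 := \prod_(a | _) _.
  have oM e : subring_gen (others (vr S) j) (\prod_(a | a != j) vr S a ^+ e a).
    by apply: gen_monomial => a neaj _; apply: mem_subring_gen; exists a.
  have sO := subring_gen_is_subring (others (vr S) j).
  apply/eqP => p0; have /(congr1 (fun p : {poly F} => p`_0)) :
      M1 *: 'X^(b.+1) + M2%:P = 0.
    apply: (iS j); last by rewrite hornerD hornerZ hornerXn hornerC.
    move=> i; rewrite coefD coefZ coefXn coefC; apply: (subringD sO).
      apply: (subringM sO); first exact: oM.
      by case: (_ == _); [apply: (subring1 sO)|apply: (subring0 sO)].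
    by case: (_ == _); [apply: oM|apply: (subring0 sO)].
  rewrite coefD coefZ coefXn coefC /= mulr0 add0r coef0.
  by apply/eqP; apply: monomial_neq0.
have k0 a : mx S a k = 0.
  by apply/eqP/negPn/negP => ak0; apply: none; exists a.
rewrite /expol !big1 //; first by move=> a _; rewrite k0.
by move=> a _; rewrite k0.
Qed.

Lemma skew_gmut S k : is_skew S -> is_skew (gmut S k).
Proof.
move=> sk a b /=; rewrite orbC; case: ifP => _; first by rewrite sk.
by rewrite [mx S b k]sk [mx S k a]sk mutation_termNN (sk a b) mutation_termC; lia.
Qed.

Lemma good_gmut S k : good S -> good (gmut S k).
Proof.
move=> gS; have [sk iS two] := gS; split=> //; first exact: skew_gmut.
apply: independent_replace => //; first exact: expol_others.
exact: expol_neq0.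
Qed.

Lemma vr_neq0 S k : good S -> vr S k != 0.
Proof. by case=> _ iS _; apply: independent_neq0. Qed.

Lemma expol_gmut S k : is_skew S -> expol (gmut S k) k = expol S k.
Proof.
move=> sk; rewrite /expol addrC; congr (_ + _); apply: eq_bigr => a _ /=;
  rewrite eqxx orbT ?opprK; case: eqVneq => // ->; by rewrite skew_diag.
Qed.

Lemma gmutK S k : good S -> gmut (gmut S k) k = S.
Proof.
move=> gS; have [sk _ _] := gS.
have P0 := expol_neq0 k gS; have x0 := vr_neq0 k gS.
rewrite {1}/gmut expol_gmut //=; case: S sk gS P0 x0 => B u sk gS P0 x0; congr GSeed.
  apply/funext => a; apply/funext => b /=; rewrite !eqxx orbT /=.
  case: (_ || _); first exact: opprK.
  by rewrite mutation_termNN; lia.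
apply/funext => a /=; rewrite eqxx; case: eqP => // ->.
by rewrite invf_div mulrC divfK.
Qed.

Lemma foldl_gmutK S ks : good S -> foldl gmut (foldl gmut S ks) (rev ks) = S.
Proof.
elim: ks S => //= k ks IHks S gS.
by rewrite rev_cons -cats1 foldl_cat IHks /= ?gmutK //; apply: good_gmut.
Qed.

Definition laurent S : set F :=
  subring_gen [set f | exists a, f = vr S a \/ f = (vr S a)^-1].

Lemma laurent_is_subring S : is_subring (laurent S).
Proof. exact: subring_gen_is_subring. Qed.

Lemma laurent_vr S a : laurent S (vr S a).
Proof. by apply: mem_subring_gen; exists a; left. Qed.

Lemma laurent_vrV S a : laurent S (vr S a)^-1.
Proof. by apply: mem_subring_gen; exists a; right. Qed.

End GSeeds.

Arguments gmut {I F}.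

#[local] Hint Resolve laurent_is_subring : core.

(** * Two directions of mutation *)

Section RankTwo.

Variables (I : finType) (F : fieldType).
Implicit Types (S : gseed I F) (i j k : I).

Definition gneg S : gseed I F := GSeed (fun a b => - mx S a b) (vr S).

Lemma expol_gneg S k : expol (gneg S) k = expol S k.
Proof.
rewrite /expol addrC; congr (_ + _); apply: eq_bigr => a _ //=.
by rewrite opprK.
Qed.

Lemma gmut_gneg S k : gmut (gneg S) k = gneg (gmut S k).
Proof.
rewrite /gmut expol_gneg /gneg /=; congr GSeed.
apply/funext => a; apply/funext => b; case: (_ || _) => //.
by rewrite mutation_termNN; lia.
Qed.

Lemma good_gneg S : good S -> good (gneg S).
Proof. by case=> sk iS two; split=> // a b /=; rewrite (sk a b). Qed.

Definition fixed S i j : set F :=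
  [set f | exists a, [/\ a != i, a != j & f = vr S a \/ f = (vr S a)^-1]].

(** The lower bound algebra of [S] with only [i] and [j] mutable and all the other
    variables invertible. *)
Definition two_mutable S i j : set F :=
  adjoin (fixed S i j)
    [:: vr S i; expol S i / vr S i; vr S j; expol S j / vr S j].

Lemma fixedC S i j : fixed S i j = fixed S j i.
Proof. by apply/seteqP; split=> f [a [? ? ?]]; exists a. Qed.

Lemma two_mutable_sym S i j f : two_mutable S i j f -> two_mutable S j i f.
Proof.
rewrite /two_mutable fixedC; apply: adjoin_sub => // x.
  exact: adjoin_base.
rewrite !inE => /or4P[] /eqP ->; apply: adjoin_mem; rewrite !inE eqxx ?orbT //.
Qed.

Definition mon S i j (e : I -> nat) : F :=
  \prod_(a | (a != i) && (a != j)) vr S a ^+ e a.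

Lemma fixed_mon S i j e : subring_gen (fixed S i j) (mon S i j e).
Proof.
apply: gen_monomial => a /andP[ai aj] _; apply: mem_subring_gen.
by exists a; split=> //; left.
Qed.

Lemma fixed_monV S i j e : subring_gen (fixed S i j) (mon S i j e)^-1.
Proof.
rewrite /mon -prodfV; under eq_bigr do rewrite -exprVn.
apply: (@gen_monomial I _ _ _ (fun a => (vr S a)^-1)) => a /andP[ai aj] _.
by apply: mem_subring_gen; exists a; split=> //; right.
Qed.

Lemma mon_neq0 S i j e : good S -> mon S i j e != 0.
Proof. by case=> _ iS _; apply: monomial_neq0. Qed.

Lemma prod_mon S i j e : i != j ->
  \prod_a vr S a ^+ e a = mon S i j e * vr S j ^+ e j * vr S i ^+ e i.
Proof.
move=> neij; rewrite (bigD1 i) //= (bigD1 j) //=; last by rewrite eq_sym.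
by rewrite /mon; ring.
Qed.

Lemma expand_power (A : set F) D V x n : is_subring A -> A D -> A V -> A x ->
  exists2 W, A W & (D + x * V) ^+ n = D ^+ n + x * W.
Proof.
move=> sA AD AV Ax; elim: n => [|n [W AW IHn]].
  by exists 0; [apply: subring0|rewrite mulr0 addr0].
exists (D * W + V * D ^+ n + x * V * W).
  have AX : A (D ^+ n) by apply: (subringX sA).
  apply: (subringD sA); last by do 2 apply: (subringM sA) => //.
  by apply: (subringD sA); apply: (subringM sA).
by rewrite !exprS IHn; ring.
Qed.

(** The neighbour of [vr S i] is three mutations away from the final cluster. With
    [P_i = A * xj ^ b + C] and [xj * xj' = D + E * xi ^ b], the product
    [xj' ^ b * P_i] is [A * D ^ b + C * xj' ^ b] up to a multiple of [xi], and the
    first part is, up to a unit, the exchange polynomial of [i] after the mutation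
    at [j], which is also divisible by [xi]. *)
Lemma rank_two_pos S i j b : good S -> i != j -> mx S j i = b.+1%:Z ->
  laurent (gmut (gmut S j) i) (expol S i / vr S i).
Proof.
move=> gS neij ji; have [sk _ _] := gS; have ij : mx S i j = - b.+1%:Z by rewrite sk ji.
set S1 := gmut S j; set S0 := gmut S1 i; set A := laurent S0.
have sA : is_subring A by apply: laurent_is_subring.
have gS1 : good S1 by apply: good_gmut.
set xi := vr S i; set xj := vr S j; set xj' := vr S1 j; set xi2 := vr S0 i.
have xi0 : xi != 0 by apply: vr_neq0.
have xj0 : xj != 0 by apply: vr_neq0.
have xj'0 : xj' != 0 by apply: vr_neq0.
have Axj' : A xj'.
  have -> : xj' = vr S0 j by rewrite /= [j == i]eq_sym (negbTE neij).
  exact: laurent_vr.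
have AVxj' : A xj'^-1.
  have -> : xj' = vr S0 j by rewrite /= [j == i]eq_sym (negbTE neij).
  exact: laurent_vrV.
have Afix f : subring_gen (fixed S i j) f -> A f.
  apply: subring_gen_sub => // x [a [nai naj]].
  have -> : vr S a = vr S0 a by rewrite /= (negbTE nai) (negbTE naj).
  by case=> ->; [apply: laurent_vr|apply: laurent_vrV].
pose g1 a := natpos (mx S a j); pose g2 a := natpos (- mx S a j).
pose b1 a := natpos (mx S a i); pose b2 a := natpos (- mx S a i).
pose c1 a := natpos (mx S a i + (natpos (mx S a j))%:Z * b.+1%:Z).
pose c2 a := natpos (- (mx S a i + (natpos (mx S a j))%:Z * b.+1%:Z)).
have Pi : expol S i = mon S i j b1 * xj ^+ b.+1 + mon S i j b2.
  by rewrite /expol !(@prod_mon _ i j) // skew_diag // ji /= !expr0 !mulr1.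
have Pj : expol S j = mon S i j g1 + xi * (mon S i j g2 * xi ^+ b).
  rewrite /expol !(@prod_mon _ i j) // skew_diag // ij opprK /= !expr0 !mulr1.
  by rewrite -/xi exprS; ring.
have Pi1 : expol S1 i = mon S i j c1 + mon S i j c2 * xj' ^+ b.+1.
  have [sk1 _ _] := gS1.
  have ji1 : mx S1 j i = - b.+1%:Z by rewrite /= eqxx ji.
  rewrite /expol !(@prod_mon _ i j) // skew_diag // ji1 opprK /= !expr0 !mulr1.
  have mut a : a != j -> (if (a == j) || (i == j) then - mx S a i else
      mx S a i + mutation_term (mx S a j) (mx S j i))
      = mx S a i + (natpos (mx S a j))%:Z * b.+1%:Z.
    move=> naj; rewrite (negbTE naj) (negbTE neij) /= ji /mutation_term /=.
    by rewrite muln0 subr0 PoszM.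
  congr (_ + _ * _); apply: eq_bigr => a /andP[nai naj] /=.
    by rewrite mut // (negbTE naj).
  by rewrite mut // (negbTE naj).
have Axi2 : A xi2 by apply: laurent_vr.
have xi20 : xi2 != 0 by apply: vr_neq0; apply: good_gmut.
have xixi2 : xi * xi2 = expol S1 i.
  rewrite /xi2 /= eqxx (negbTE neij) -/xi mulrC divfK //.
have Axi : A xi.
  have -> : xi = expol S1 i * xi2^-1 by rewrite -xixi2 mulfK.
  apply: (subringM sA) => //; last exact: laurent_vrV.
  rewrite Pi1; apply: (subringD sA) => //; first by apply: Afix; apply: fixed_mon.
  by apply: (subringM sA) => //; [apply: Afix; apply: fixed_mon|apply: (subringX sA)].
have [W AW EW] : exists2 W, A W & (xj * xj') ^+ b.+1 = mon S i j g1 ^+ b.+1 + xi * W.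
  have -> : xj * xj' = expol S j by rewrite /xj' /= eqxx mulrC divfK.
  rewrite Pj; apply: expand_power => //; first by apply: Afix; apply: fixed_mon.
  by apply: (subringM sA) => //; [apply: Afix; apply: fixed_mon|apply: (subringX sA)].
have key : mon S i j c2 * mon S i j b1 * mon S i j g1 ^+ b.+1
         = mon S i j b2 * mon S i j c1.
  rewrite /mon -prodrXl -!big_split; apply: eq_bigr => a _ /=.
  rewrite -exprM -!exprD; congr (_ ^+ _).
  have := natposE (mx S a i); have := natposE (- mx S a i).
  rewrite /c1 /c2 /b1 /b2 /g1; set m := _ + _.
  have := natposE m; have := natposE (- m); rewrite /m; lia.
have -> : expol S i / vr S i
    = (mon S i j b2 * xi2 + mon S i j c2 * mon S i j b1 * W)
      * ((mon S i j c2)^-1 * xj'^-1 ^+ b.+1).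
  have c20 := mon_neq0 i j c2 gS.
  have xX : xj' ^+ b.+1 != 0 by rewrite expf_neq0.
  apply: (mulIf xi0); rewrite divfK //.
  apply: (mulIf c20); apply: (mulIf xX).
  transitivity (xi * mon S i j b2 * xi2 + mon S i j c2 * mon S i j b1 * (xi * W)).
    have -> : xi * W = (xj * xj') ^+ b.+1 - mon S i j g1 ^+ b.+1 by rewrite EW; ring.
    have -> : xi * mon S i j b2 * xi2 = mon S i j b2 * (xi * xi2) by ring.
    rewrite xixi2 Pi Pi1 mulrBr key exprMn; ring.
  by rewrite exprVn; field; rewrite c20 expf_neq0.
have Am e : A (mon S i j e) by apply: Afix; apply: fixed_mon.
apply: (subringM sA) => //.
  by apply: (subringD sA) => //; apply: (subringM sA) => //; apply: (subringM sA).
apply: (subringM sA) => //; first by apply: Afix; apply: fixed_monV.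
exact: (subringX sA).
Qed.

Lemma laurent_gneg S f : laurent (gneg S) f = laurent S f.
Proof. by []. Qed.

Lemma rank_two S i j : good S -> i != j ->
  laurent (gmut (gmut S j) i) (expol S i / vr S i).
Proof.
move=> gS neij; have [sk _ _] := gS; case ji: (mx S j i) => [[|b]|b].
- suff -> : expol S i / vr S i = vr (gmut (gmut S j) i) i by apply: laurent_vr.
  rewrite /= eqxx (negbTE neij) /=; congr (_ / _).
  have col a : mx (gmut S j) a i = mx S a i.
    rewrite /= (negbTE neij) orbF; case: eqVneq => [->|_]; rewrite ji //.
    by rewrite /mutation_term /= !muln0 addr0.
  rewrite /expol; congr (_ + _); apply: eq_bigr => a _; rewrite col /=;
    by case: eqVneq => // ->; rewrite ji !expr0.
- exact: rank_two_pos ji.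
- rewrite -laurent_gneg -!gmut_gneg -expol_gneg -[vr S i]/(vr (gneg S) i).
  by apply: (@rank_two_pos _ _ _ b) => //; [apply: good_gneg|rewrite /= ji].
Qed.

(** All the generators are obtained from the exchange relations on the way, except
    for the neighbour of [vr S i], which is the subject of [rank_two]. *)
Lemma two_mutable_laurent S i j f : good S -> i != j ->
  two_mutable S i j f -> laurent (gmut (gmut S j) i) f.
Proof.
move=> gS neij; have [sk _ _] := gS.
set S1 := gmut S j; set S0 := gmut S1 i; set A := laurent S0.
have sA : is_subring A by apply: laurent_is_subring.
have gS1 : good S1 by apply: good_gmut.
have S0E a : a != i -> vr S0 a = vr S1 a by move=> nai; rewrite /= (negbTE nai).
have Axj' : A (vr S1 j) by rewrite -S0E 1?eq_sym //; apply: laurent_vr.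
have AVxj' : A (vr S1 j)^-1 by rewrite -S0E 1?eq_sym //; apply: laurent_vrV.
have Afix f' : fixed S i j f' -> A f'.
  move=> [a [nai naj]].
  have -> : vr S a = vr S0 a by rewrite /= (negbTE nai) (negbTE naj).
  by case=> ->; [apply: laurent_vr|apply: laurent_vrV].
have Axi : A (vr S i).
  have -> : vr S i = expol S1 i * (vr S0 i)^-1.
    rewrite /= eqxx (negbTE neij) invf_div mulrC divfK //.
    exact: expol_neq0.
  apply: (subringM sA) => //; last exact: laurent_vrV.
  have [sk1 _ _] := gS1.
  apply: (subring_gen_sub sA _ (expol_others sk1)) => _ [a nai ->].
  by rewrite -S0E //; apply: laurent_vr.
apply: (adjoin_sub sA Afix) => x; rewrite !inE => /or4P[] /eqP -> //.
- exact: rank_two.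
- have -> : vr S j = expol S j * (vr S1 j)^-1.
    by rewrite /= eqxx invf_div mulrC divfK //; apply: expol_neq0.
  apply: (subringM sA) => //; apply: (subring_gen_sub sA _ (expol_others sk)) => _ [a naj ->].
  have [-> //|nai] := eqVneq a i.
  by apply: Afix; exists a; split=> //; left.
- by move: Axj'; rewrite /= eqxx.
Qed.

End RankTwo.

(** [A w + C] is not a zero divisor modulo [d], since its constant coefficient
    [C] is a unit. *)
Lemma linear_coprime (F : fieldType) (R : set F) (w A C d h : F) :
  is_subring R -> transcendental R w ->
  R A -> R C -> R C^-1 -> C != 0 -> R d -> d != 0 ->
  adjoin R [:: w; w^-1] (d * h) ->
  adjoin R [:: w; w^-1] (h * (A * w + C)) -> adjoin R [:: w; w^-1] h.
Proof.
move=> sR tw RA RC RC' C0 Rd d0.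
have w0 := transcendental_neq0 sR tw.
move=> /(adjoinVP sR w0)[N [p Rp dhN]] /(adjoinVP sR w0)[M [q Rq hM]].
pose P := p * 'X^M; pose Q := q * 'X^N.
have RP i : R P`_i.
  by rewrite coefMXn; case: ifP => _ //; apply: subring0.
have RQ i : R Q`_i.
  by rewrite coefMXn; case: ifP => _ //; apply: subring0.
have PQ : A *: (P * 'X) + C *: P = d *: Q.
  apply: (transcendental_inj sR tw) => [i|i|].
  - rewrite coefD !coefZ coefMX; apply: subringD => //; last exact: subringM.
    by apply: subringM => //; case: ifP => _ //; apply: subring0.
  - by rewrite coefZ; apply: subringM.
  - by rewrite hornerD !hornerZ !hornerM hornerX !hornerXn -dhN -hM; ring.
have divd i : R (P`_i / d).
  elim: i => [|i IHi].
    have := congr1 (fun r : {poly F} => r`_0) PQ.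
    rewrite coefD !coefZ coefMX /= mulr0 add0r => CP.
    have -> : P`_0 / d = Q`_0 * C^-1.
      by apply: (mulfI C0); rewrite mulrA CP; field; rewrite C0 d0.
    exact: subringM.
  have := congr1 (fun r : {poly F} => r`_i.+1) PQ.
  rewrite coefD !coefZ coefMX /= => CP.
  have -> : P`_i.+1 / d = (Q`_i.+1 - A * (P`_i / d)) * C^-1.
    apply: (mulfI C0); apply: (mulfI d0).
    transitivity (C * P`_i.+1); first by field.
    transitivity (d * Q`_i.+1 - A * P`_i); last by field; rewrite C0 d0.
    by rewrite -CP; ring.
  by apply: subringM => //; apply: subringB => //; apply: subringM.
have sW := adjoin_is_subring R [:: w; w^-1].
have wW : adjoin R [:: w; w^-1] w by apply: adjoin_mem; rewrite !inE eqxx.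
have -> : h = (\poly_(i < size P) (P`_i / d)).[w] * w^-1 ^+ (N + M).
  rewrite horner_poly; have wX : w ^+ (N + M) != 0 by rewrite expf_neq0.
  rewrite exprVn; apply: (mulIf wX); rewrite divfK //; apply: (mulfI d0).
  transitivity P.[w].
    by rewrite hornerM -dhN hornerXn exprD; ring.
  by rewrite horner_coef mulr_sumr; apply: eq_bigr => i _; field.
apply: (subringM sW); last first.
  by apply: (subringX sW); apply: adjoin_mem; rewrite !inE eqxx orbT.
apply: (subring_horner sW) => // i; apply: adjoin_base; rewrite coef_poly.
by case: ifP => _ //; apply: (subring0 sR).
Qed.

Section TwoMutable.

Variables (I : finType) (F : fieldType).
Implicit Types (S : gseed I F) (i j k : I).

Lemma transcendental_vr S i (E : set F) : good S ->
  (forall y, E y -> fractions (subring_gen (others (vr S) i)) y) ->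
  transcendental E (vr S i).
Proof.
move=> [_ iS _] EF; apply: (transcendentalS EF).
exact: (transcendental_fractions (subring_gen_is_subring _) (iS i)).
Qed.

Lemma fractions_vr S i a : a != i ->
  fractions (subring_gen (others (vr S) i)) (vr S a).
Proof.
move=> nai; apply: (sub_fractions (subring_gen_is_subring _)).
by apply: mem_subring_gen; exists a.
Qed.

Lemma fractions_others_is_subring S i :
  is_subring (fractions (subring_gen (others (vr S) i))).
Proof. exact: (fractions_is_subring (subring_gen_is_subring _)). Qed.

Lemma fractions_othersV S i f :
  fractions (subring_gen (others (vr S) i)) f ->
  fractions (subring_gen (others (vr S) i)) f^-1.
Proof. exact: (fractionsV (subring_gen_is_subring _)). Qed.

Lemma fractions_fixed S i j f : subring_gen (fixed S i j) f ->
  fractions (subring_gen (others (vr S) i)) f.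
Proof.
apply: (subring_gen_sub (fractions_others_is_subring S i)) => x [a [nai _]].
by case=> ->; [|apply: fractions_othersV]; apply: fractions_vr.
Qed.

(** The coefficients of expansions in the variable of [i]; the variable of [j] is
    split off for comparison with [two_mutable]. *)
Definition laurent_but S i j : set F :=
  adjoin (fixed S i j) [:: vr S j; (vr S j)^-1].

Lemma laurent_but_is_subring S i j : is_subring (laurent_but S i j).
Proof. exact: adjoin_is_subring. Qed.

Lemma laurent_but_fractions S i j f : i != j -> laurent_but S i j f ->
  fractions (subring_gen (others (vr S) i)) f.
Proof.
move=> neij; apply: (adjoin_sub (fractions_others_is_subring S i)).
  by move=> x fx; apply: (@fractions_fixed _ _ j); apply: mem_subring_gen.
have vj : fractions (subring_gen (others (vr S) i)) (vr S j).
  by apply: fractions_vr; rewrite eq_sym.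
by move=> x; rewrite !inE => /orP[] /eqP -> //; apply: fractions_othersV.
Qed.

Lemma laurent_adjoin S S' i j f : i != j ->
  (forall a, a != i -> vr S' a = vr S a) -> laurent S' f ->
  adjoin (laurent_but S i j) [:: vr S' i; (vr S' i)^-1] f.
Proof.
move=> neij S'S; apply: subring_genS => y [a ay].
have [eqai|nai] := eqVneq a i.
  by case: ay => ->; rewrite eqai; apply: adjoin_mem; rewrite !inE eqxx ?orbT.
rewrite (S'S a nai) in ay; apply: adjoin_base.
have [eqaj|naj] := eqVneq a j.
  by case: ay => ->; rewrite eqaj; apply: adjoin_mem; rewrite !inE eqxx ?orbT.
by apply: adjoin_base; exists a.
Qed.

Lemma expol_laurent_but S i j : good S -> i != j -> laurent_but S i j (expol S i).
Proof.
move=> [sk _ _] neij.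
apply: (subring_gen_sub (laurent_but_is_subring S i j) _ (expol_others sk)) => _ [a nai ->].
have [->|naj] := eqVneq a j; first by apply: adjoin_mem; rewrite inE eqxx.
by apply: adjoin_base; exists a; split=> //; left.
Qed.

Lemma laurent_one_mutable S i j f : good S -> i != j ->
  laurent S f -> laurent (gmut S i) f ->
  adjoin (laurent_but S i j) [:: vr S i; expol S i / vr S i] f.
Proof.
move=> gS neij Sf Sif; have sE := laurent_but_is_subring S i j.
apply: (laurent_exchange sE sE) => //.
- by apply: transcendental_vr => // y; apply: laurent_but_fractions.
- exact: expol_laurent_but.
- exact: expol_neq0.
- exact: laurent_adjoin.
- have -> : expol S i / vr S i = vr (gmut S i) i by rewrite /= eqxx.
  by apply: laurent_adjoin => // a nai; rewrite /= (negbTE nai).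
Qed.

(** Allowing the inverse of the variable of [j], [laurent_one_mutable] already
    places [f] in the required ring. *)
Lemma two_mutable_clear S i j f : good S -> i != j ->
  laurent S f -> laurent (gmut S i) f ->
  exists N, two_mutable S i j (f * vr S j ^+ N).
Proof.
move=> gS neij Sf Sif; have sT : is_subring (two_mutable S i j) by apply: adjoin_is_subring.
apply: (adjoinV_clear sT _ (vr_neq0 j gS)).
  by apply: adjoin_mem; rewrite !inE eqxx ?orbT.
apply: (adjoin_sub (adjoin_is_subring _ _) _ _ (laurent_one_mutable gS neij Sf Sif)).
  move=> y; apply: (adjoin_sub (adjoin_is_subring _ _)) => x Gx.
    by do 2 apply: adjoin_base.
  exact: adjoin_mem.
move=> y yi; apply: adjoin_base; apply: adjoin_mem.
by move: yi; rewrite !inE => /orP[] ->; rewrite ?orbT.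
Qed.

(** Since [i] and [j] are joined, exactly one monomial of the exchange polynomial
    of [i] involves [vr S j], and the other one is a unit: [vr S i] and [vr S j]
    generate the unit ideal. *)
Lemma two_mutable_edge S i j f : good S -> i != j -> mx S j i != 0 ->
  laurent S f -> laurent (gmut S i) f -> laurent (gmut S j) f ->
  two_mutable S i j f.
Proof.
move=> gS neij ji Sf Sif Sjf; have [sk _ _] := gS.
have sT : is_subring (two_mutable S i j) by apply: adjoin_is_subring.
have [M fM] := two_mutable_clear gS neij Sf Sif.
have neji : j != i by rewrite eq_sym.
have [N /two_mutable_sym fN] := two_mutable_clear gS neji Sf Sjf.
have [b [e1 [e2 [e1i e2i Pi]]]] := expol_split sk ji.
set M1 := \prod_(a | _) _ ^+ e1 a in Pi; set M2 := \prod_(a | _) _ ^+ e2 a in Pi.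
have monE e : e i = 0%N -> \prod_(a | a != j) vr S a ^+ e a = mon S i j e.
  move=> ei; rewrite (bigD1 i) //= ei expr0 mul1r /mon.
  by apply: eq_bigl => a; rewrite andbC.
have TM e : two_mutable S i j (mon S i j e) by apply: adjoin_gen; apply: fixed_mon.
have TMV e : two_mutable S i j (mon S i j e)^-1.
  by apply: adjoin_gen; apply: fixed_monV.
have M20 : M2 != 0 by rewrite /M2 monE //; apply: mon_neq0.
have [xi xj] : two_mutable S i j (vr S i) /\ two_mutable S i j (vr S j).
  by split; apply: adjoin_mem; rewrite !inE eqxx ?orbT.
have xi' : two_mutable S i j (expol S i / vr S i).
  by apply: adjoin_mem; rewrite !inE eqxx ?orbT.
apply: (unit_ideal_clear sT xi xj _ _ _ fN fM
         (a := M2^-1 * (expol S i / vr S i)) (b := M2^-1 * (- M1 * vr S j ^+ b))).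
- by apply: (subringM sT) => //; rewrite /M2 monE.
- apply: (subringM sT); first by rewrite /M2 monE.
  apply: (subringM sT); last exact: (subringX sT).
  by apply: (subringN sT); rewrite /M1 monE.
- have x0 := vr_neq0 i gS; rewrite -!mulrA mulVf // mulr1 Pi exprSr.
  by field.
Qed.

(** The exchange polynomials of [i] and [j] involve neither variable and are coprime
    by [linear_coprime], as the variable of [o] occurs only in the first one, where
    it is linear. Knowing [f] in three clusters of a square then suffices: first
    [laurent_exchange] is applied in the variable of [i], over coefficients which
    are known to be polynomials in [vr S j] and its neighbour; that these stay so
    after division by a power of [expol S i] is [laurent_exchange] in the variable
    of [j], and coprimality. *)
Lemma two_mutable_square S i j o f : good S -> i != j -> o != i -> o != j ->
  mx S j i = 0 -> mx S o j = 0 -> mx S o i = 1 ->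
  laurent S f -> laurent (gmut S i) f -> laurent (gmut S j) f ->
  two_mutable S i j f.
Proof.
move=> gS neij noi noj ji oj oi Sf Sif Sjf; have [sk _ _] := gS.
have neji : j != i by rewrite eq_sym.
have ij : mx S i j = 0 by rewrite sk ji oppr0.
pose R0 := subring_gen (fixed S i j).
have sR0 : is_subring R0 by apply: subring_gen_is_subring.
set xi := vr S i; set xj := vr S j; set w := vr S o.
set Pi := expol S i; set Pj := expol S j.
have xi0 : xi != 0 by apply: vr_neq0.
have xj0 : xj != 0 by apply: vr_neq0.
have Pi0 : Pi != 0 by apply: expol_neq0.
have Pj0 : Pj != 0 by apply: expol_neq0.
pose G00 : set F := [set f | exists a, [/\ a != i, a != j, a != o &
                             f = vr S a \/ f = (vr S a)^-1]].
pose R := subring_gen G00.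
have sR : is_subring R by apply: subring_gen_is_subring.
have RR0 y : R y -> R0 y.
  by apply: subring_genS => x [a [? ? ? ?]]; apply: mem_subring_gen; exists a.
pose m (e : I -> nat) := \prod_(a | (a != i) && (a != j) && (a != o)) vr S a ^+ e a.
have Rm e : R (m e).
  apply: gen_monomial => a /andP[/andP[? ?] ?] _; apply: mem_subring_gen.
  by exists a; split=> //; left.
have RmV e : R (m e)^-1.
  rewrite /m -prodfV; under eq_bigr do rewrite -exprVn.
  apply: (@gen_monomial I _ _ _ (fun a => (vr S a)^-1)) => a /andP[/andP[? ?] ?] _.
  by apply: mem_subring_gen; exists a; split=> //; right.
have m0 e : m e != 0 by case: gS => _ iS _; apply: monomial_neq0.
have prodm e : e i = 0%N -> e j = 0%N ->
    \prod_a vr S a ^+ e a = m e * w ^+ e o.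
  move=> ei ej; rewrite (prod_mon S e neij) ei ej !expr0 !mulr1.
  by rewrite /mon (bigD1 o) ?noi ?noj //= mulrC.
pose b1 a := natpos (mx S a i); pose b2 a := natpos (- mx S a i).
have PiE : Pi = m b1 * w + m b2.
  rewrite /Pi /expol (prodm b1) /b1 ?skew_diag ?ji // oi expr1; congr (_ + _).
  by rewrite (prodm b2) /b2 ?skew_diag ?ji ?oi // mulr1.
have RPj : R Pj.
  rewrite /Pj /expol (prodm (fun a => natpos (mx S a j))) ?skew_diag ?ij //.
  rewrite (prodm (fun a => natpos (- mx S a j))) ?skew_diag ?ij // oj !mulr1.
  exact: (subringD sR).
have R0Pi : R0 Pi.
  rewrite PiE; apply: (subringD sR0); last by apply: RR0; apply: Rm.
  apply: (subringM sR0); first by apply: RR0; apply: Rm.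
  by apply: mem_subring_gen; exists o; split=> //; left.
have R0Pj : R0 Pj by apply: RR0.
(* [linear_coprime] is stated for Laurent polynomials in [w] over [R] *)
have R0w y : R0 y -> adjoin R [:: w; w^-1] y.
  apply: subring_genS => x [a [nai naj xa]].
  have [eqao|nao] := eqVneq a o.
    by apply: adjoin_mem; case: xa => ->; rewrite eqao !inE eqxx ?orbT.
  by apply: adjoin_base; apply: mem_subring_gen; exists a.
have wR0 y : adjoin R [:: w; w^-1] y -> R0 y.
  apply: (adjoin_sub sR0) => // x xw; apply: mem_subring_gen; exists o; split=> //.
  by move: xw; rewrite !inE => /orP[] /eqP ->; [left|right].
have tw : transcendental R w.
  apply: transcendental_vr => // y.
  apply: (subring_gen_sub (fractions_others_is_subring S o)) => x [a [_ _ nao]].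
  by case=> ->; [|apply: fractions_othersV]; apply: fractions_vr.
have coprime c h N : R0 (Pj ^+ c * h) -> R0 (h * Pi ^+ N) -> R0 h.
  elim: N h => [|N IHN] h hj hi; first by rewrite mulr1 in hi.
  have hPi : R0 (h * Pi).
    by apply: IHN; [rewrite mulrA; apply: (subringM sR0)|rewrite -mulrA -exprS].
  apply: wR0; apply: (@linear_coprime _ R w (m b1) (m b2) (Pj ^+ c)) => //.
  - exact: (subringX sR).
  - by rewrite expf_neq0.
  - exact: R0w.
  - by apply: R0w; rewrite -PiE.
have fr_R0 k y : k = i \/ k = j -> R0 y -> fractions (subring_gen (others (vr S) k)) y.
  move=> ijk; apply: (subring_gen_sub (fractions_others_is_subring S k)) => x [a [nai naj]].
  have nak : a != k by case: ijk => ->.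
  by case=> ->; [|apply: fractions_othersV]; apply: fractions_vr.
pose E := adjoin R0 [:: xj; Pj / xj]; pose E' := adjoin R0 [:: xj; xj^-1].
have sE : is_subring E by apply: adjoin_is_subring.
have sE' : is_subring E' by apply: adjoin_is_subring.
have E'xj : E' xj by apply: adjoin_mem; rewrite inE eqxx.
have E'xjV : E' xj^-1 by apply: adjoin_mem; rewrite !inE eqxx orbT.
have EE' y : E y -> E' y.
  apply: (adjoin_sub sE') => x; first exact: adjoin_base.
  rewrite !inE => /orP[] /eqP -> //; apply: (subringM sE') => //.
  exact: adjoin_base.
have inner e c : E e -> E' (e / Pi ^+ c) -> E (e / Pi ^+ c).
  move=> Ee E'g.
  pose RV := adjoin R0 [:: Pi; Pi^-1].
  have sRV : is_subring RV by apply: adjoin_is_subring.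
  apply: (laurent_exchange sR0 sRV) => //; first by move=> y; apply: adjoin_base.
  - apply: transcendental_vr => // y; have sF := fractions_others_is_subring S j.
    apply: (adjoin_sub sF) => x; first by apply: fr_R0; right.
    by rewrite !inE => /orP[] /eqP ->; [|apply: fractions_othersV];
      apply: fr_R0 => //; right.
  - move=> r a R0r /(adjoinV_clear sR0 R0Pi Pi0)[N rN].
    by apply: (coprime a _ _ _ rN); rewrite mulrC divfK ?expf_neq0.
  - have sX := adjoin_is_subring RV [:: Pj / xj; (Pj / xj)^-1].
    apply: (subringM sX).
      apply: (adjoin_sub sX _ _ Ee) => y; first by move=> R0y; do 2 apply: adjoin_base.
      rewrite !inE => /orP[] /eqP ->; last by apply: adjoin_mem; rewrite inE eqxx.
      have xjE : Pj * (Pj / xj)^-1 = xj by rewrite invf_div mulrC divfK.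
      rewrite -[X in adjoin _ _ X]xjE; apply: (subringM sX); first by do 2 apply: adjoin_base.
      by apply: adjoin_mem; rewrite !inE eqxx orbT.
    apply: adjoin_base; rewrite -exprVn; apply: (subringX sRV).
    by apply: adjoin_mem; rewrite !inE eqxx orbT.
apply: (@adjoin_sub _ E [:: xi; Pi / xi] _ (adjoin_is_subring _ _)).
- move=> y; apply: (adjoin_sub (adjoin_is_subring _ _)) => x; first exact: adjoin_gen.
  by rewrite !inE => /orP[] /eqP ->; apply: adjoin_mem; rewrite !inE eqxx ?orbT.
- by move=> y; rewrite !inE => /orP[] /eqP ->; apply: adjoin_mem; rewrite !inE eqxx ?orbT.
apply: (laurent_exchange sE sE') => //.
- apply: transcendental_vr => // y; have sF := fractions_others_is_subring S i.
  apply: (adjoin_sub sF) => x; first by apply: fr_R0; left.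
  by rewrite !inE => /orP[] /eqP ->; [|apply: fractions_othersV]; apply: fractions_vr.
- exact: adjoin_base.
- apply: (adjoin_sub (adjoin_is_subring _ _) _ _ (laurent_one_mutable gS neji Sf Sjf)).
    move=> y; rewrite /laurent_but fixedC.
    apply: (adjoin_sub (adjoin_is_subring _ _)) => x Gx.
      by do 2 apply: adjoin_base; apply: mem_subring_gen.
    exact: adjoin_mem.
  by move=> y y_j; apply: adjoin_base; apply: adjoin_mem.
- have := @laurent_adjoin S (gmut S i) i j f neij.
  rewrite /= eqxx => /(_ _ Sif) fi.
  apply: (adjoin_sub (adjoin_is_subring _ _) _ _ (fi _)) => [y|y yi|a /negbTE -> //].
    apply: (adjoin_sub (adjoin_is_subring _ _)) => x Gx; apply: adjoin_base.
      by apply: adjoin_base; apply: mem_subring_gen.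
    exact: adjoin_mem.
  exact: adjoin_mem.
Qed.

End TwoMutable.

(** * The Laurent phenomenon *)

Lemma prod_option (I : finType) (R : comPzSemiRingType) (f : option I -> R) :
  \prod_a f a = f None * \prod_a f (Some a).
Proof.
rewrite (bigD1 None) //=; congr (_ * _).
rewrite (reindex_omap Some id) /=; last by case.
by apply: eq_bigl => a; rewrite eqxx.
Qed.

Section ExtraVertex.

Variables (I : finType) (F : fieldType).
Implicit Types (S : gseed I F) (i j k : I).

(** The new vertex [None] makes the exchange polynomial of [i] linear in a variable
    which occurs in no other exchange polynomial. *)
Definition extend S i : gseed (option I) (ratfun F) :=
  GSeed (fun a b => match a, b with
                    | Some a, Some b => mx S a b
                    | None, Some b => (b == i)%:Z
                    | Some a, None => - (a == i)%:Z
                    | None, None => 0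
                    end)
        (fun a => if a is Some a then cst (vr S a) else var F).

Lemma good_extend S i : good S -> good (extend S i).
Proof.
move=> [sk iS two]; split.
- by move=> [a|] [b|] //=; rewrite ?opprK ?oppr0.
- move=> [a|] /=; last first.
    apply: (transcendentalS _ (@transcendental_var F)).
    apply: (subring_gen_sub (image_cst_is_subring _)).
      by apply: is_subringP; split.
    by move=> _ [[b|] // _ ->] /=; exists (vr S b).
  pose G : set (ratfun F) := [set f | exists2 b, b != a & f = cst (vr S b)].
  apply: (@transcendentalS _ (adjoin G [:: var F])).
    apply: (subring_gen_sub (adjoin_is_subring _ _)) => _ [[b|] neba ->].
      by apply: adjoin_base; exists b.
    by apply: adjoin_mem; rewrite inE.
  apply: transcendental_exchange.
    apply: (transcendentalS _ (transcendental_cst (subring_gen_is_subring _) (iS a))).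
    apply: (subring_gen_sub (image_cst_is_subring (subring_gen_is_subring _))).
    by move=> _ [b neba ->]; exists (vr S b) => //; apply: mem_subring_gen; exists b.
  apply: (transcendentalS _ (@transcendental_var F)).
  apply: (adjoin_sub (image_cst_is_subring _)).
    + by apply: is_subringP; split.
    + by move=> _ [b _ ->]; exists (vr S b).
    + by move=> x; rewrite inE => /eqP ->; exists (vr S a).
- by rewrite -(rmorph_nat (@cst F)) fmorph_eq0.
Qed.

(** Setting the variable of [None] to 1 erases this vertex from the exchange
    relations, so that the relation is kept by mutations. *)
Definition restricts (T : gseed (option I) (ratfun F)) S : Prop :=
  [/\ forall a b, mx T (Some a) (Some b) = mx S a b,
      forall a, specialises 1 (vr T (Some a)) (vr S a)
    & specialises 1 (vr T None) 1].

Lemma restricts_extend S i : restricts (extend S i) S.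
Proof.
split=> //; first by move=> a; apply: specialises_cst.
exact: specialises_var.
Qed.

Lemma restricts_gmut T S k : good S -> restricts T S ->
  restricts (gmut T (Some k)) (gmut S k).
Proof.
move=> gS [TS vTS wT]; split=> [a b|a|]; last exact: wT.
  by rewrite /= !TS.
have gmutE (J : finType) (K : fieldType) (T' : gseed J K) (l a' : J) :
    vr (gmut T' l) a' = if a' == l then expol T' l / vr T' l else vr T' a' by [].
rewrite !gmutE (_ : (Some a == Some k) = (a == k)) //; case: (a == k); last exact: vTS.
have exps (e : option I -> nat) : specialises 1
    (\prod_a vr T a ^+ e a) (\prod_a vr S a ^+ e (Some a)).
  rewrite prod_option -[X in specialises _ _ X]mul1r; apply: specialisesM.
    by have := specialisesX (e None) wT; rewrite expr1n.
  by apply: specialises_prod => b _; apply: specialisesX.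
apply: specialises_div => //; first exact: vr_neq0.
rewrite /expol; apply: specialisesD.
  under [X in specialises _ _ X]eq_bigr do rewrite -TS.
  exact: (exps (fun a => natpos (mx T a (Some k)))).
under [X in specialises _ _ X]eq_bigr do rewrite -TS.
exact: (exps (fun a => natpos (- mx T a (Some k)))).
Qed.

Lemma restricts_foldl T S ks : good S -> restricts T S ->
  restricts (foldl gmut T (map Some ks)) (foldl gmut S ks).
Proof.
elim: ks T S => //= k ks IHks T S gS TS; apply: IHks; first exact: good_gmut.
exact: restricts_gmut.
Qed.

Lemma restricts_laurent T S f g : good S -> restricts T S ->
  specialises 1 g f -> laurent T g -> laurent S f.
Proof.
move=> gS [_ vTS wT] gf Tg.
have SV a : laurent S (vr S a) /\ laurent S (vr S a)^-1.
  by split; [apply: laurent_vr|apply: laurent_vrV].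
have [_ [[a|] [] ->]|f' Sf' gf'] := @specialises_gen F 1 _ (laurent S) g _ Tg.
- by exists (vr S a) => //; case: (SV a).
- exists (vr S a)^-1; first by case: (SV a).
  by apply: specialisesV; first exact: vr_neq0.
- by exists 1 => //; apply: (subring1 (laurent_is_subring S)).
- exists 1; first exact: (subring1 (laurent_is_subring S)).
  by have := specialisesV (oner_neq0 F) wT; rewrite invr1.
rewrite (specialises_fun gf gf').
exact: (subring_gen_sub (laurent_is_subring S) _ Sf').
Qed.

End ExtraVertex.

Lemma laurent_gmut (I : finType) (F : fieldType) (S : gseed I F) i k :
  good S -> laurent S (vr (gmut S i) k).
Proof.
move=> [sk _ _] /=; case: eqP => _; last exact: laurent_vr.
apply: (subringM (laurent_is_subring S)); last exact: laurent_vrV.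
apply: (subring_gen_sub (laurent_is_subring S) _ (expol_others sk)).
by move=> _ [a _ ->]; apply: laurent_vr.
Qed.

(** Induction on the length of the sequence, simultaneously for all matrices and
    fields since the field changes when a vertex is added. After the first two
    steps, in directions [i] and [j], the seed [S2] is reached; the final element
    is obtained from [S2] and from its two neighbours in these directions by shorter
    sequences, as mutations are involutive. *)
Theorem laurent_phenomenon (I : finType) (F : fieldType) (S : gseed I F) ks k :
  good S -> laurent S (vr (foldl gmut S ks) k).
Proof.
have [N leN] := ubnP (size ks).
elim: N => // N IHN in I F S ks k leN *.
case: ks leN => [|i [|j ks]] /= leN gS; first exact: laurent_vr.
  exact: laurent_gmut.
have [<-|neij] := eqVneq i j; first by rewrite gmutK //; apply: IHN => //; lia.
set S2 := gmut (gmut S i) j; set f := vr _ k.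
have gS2 : good S2 by do 2 apply: good_gmut.
suff : laurent (gmut (gmut S2 j) i) f.
  by rewrite /S2 (gmutK j (good_gmut i gS)) (gmutK i gS).
have path (J : finType) (K : fieldType) (T : gseed J K) l ls k' : good T ->
    ((size ls).+1 < N)%N -> laurent (gmut T l) (vr (foldl gmut T ls) k').
  move=> gT lels; rewrite -{2}(gmutK l gT).
  by apply: (IHN _ _ (gmut T l) (l :: ls)) => //; apply: good_gmut.
have [ji0|ji0] := eqVneq (mx S2 j i) 0; last first.
  apply: two_mutable_laurent => //.
  by apply: two_mutable_edge => //; [apply: IHN => //; lia|apply: path..].
set T := extend S2 i; set g := vr (foldl gmut T (map Some ks)) (Some k).
have gT : good T by apply: good_extend.
have TS2 := restricts_extend S2 i.
have gf : specialises 1 g f by case: (restricts_foldl ks gS2 TS2) => _ + _; apply.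
have Tg : two_mutable T (Some i) (Some j) g.
  apply: (@two_mutable_square _ _ T _ _ None) => //=.
  - by rewrite eq_sym (negbTE neij).
  - by rewrite eqxx.
  - by apply: IHN => //; rewrite size_map; lia.
  - by apply: path; rewrite ?size_map.
  - by apply: path; rewrite ?size_map.
have gS2j := good_gmut j gS2.
suff Tgm : laurent (gmut (gmut T (Some j)) (Some i)) g.
  suff TS : restricts (gmut (gmut T (Some j)) (Some i)) (gmut (gmut S2 j) i).
    exact: (restricts_laurent (good_gmut i gS2j) TS gf Tgm).
  by apply: restricts_gmut => //; apply: restricts_gmut.
by apply: two_mutable_laurent.
Qed.

(** * Polynomiality in the frozen variables *)

Section Frozen.

Variables (I : finType) (F : fieldType).
Implicit Types (S : gseed I F) (i j k o : I).

Definition laurent_pos S (P : pred I) : set F :=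
  subring_gen [set f | exists a, f = vr S a \/ (~~ P a /\ f = (vr S a)^-1)].

Lemma laurent_pos_is_subring S P : is_subring (laurent_pos S P).
Proof. exact: subring_gen_is_subring. Qed.

Lemma laurent_pos_vr S P a : laurent_pos S P (vr S a).
Proof. by apply: mem_subring_gen; exists a; left. Qed.

Lemma laurent_pos_vrV S (P : pred I) a : ~~ P a -> laurent_pos S P (vr S a)^-1.
Proof. by move=> Pa; apply: mem_subring_gen; exists a; right. Qed.

(** As [None] is joined to [o] only, mutations elsewhere neither create arrows at
    [None] nor involve its variable. *)
Definition extends o (T : gseed (option I) (ratfun F)) S : Prop :=
  [/\ forall a b, mx T (Some a) (Some b) = mx S a b,
      forall a, vr T (Some a) = cst (vr S a)
    & forall a, a != o -> mx T None (Some a) = 0].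

Lemma expol_extends o T S k : extends o T S -> k != o ->
  expol T (Some k) = cst (expol S k).
Proof.
move=> [TS vTS oT] neko; rewrite /expol rmorphD !rmorph_prod !prod_option oT //=.
rewrite !expr0 !mul1r.
by congr (_ + _); apply: eq_bigr => a _; rewrite vTS TS rmorphXn.
Qed.

Lemma extends_gmut o T S k : extends o T S -> k != o ->
  extends o (gmut T (Some k)) (gmut S k).
Proof.
move=> ext neko; have [TS vTS oT] := ext.
split=> [a b|a|a neao]; first by rewrite /= !TS.
  have -> : vr (gmut T (Some k)) (Some a) = if a == k
    then expol T (Some k) / vr T (Some k) else vr T (Some a) by [].
  rewrite (expol_extends ext) // !vTS -fmorph_div.
  by rewrite -(fun_if (@cst F)).
rewrite /= oT // (oT k) // oppr0 add0r.
by case: ifP => // _; rewrite /mutation_term !mul0n.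
Qed.

Lemma extends_foldl o T S ks : extends o T S -> o \notin ks ->
  extends o (foldl gmut T (map Some ks)) (foldl gmut S ks).
Proof.
elim: ks T S => //= k ks IHks T S ext; rewrite inE negb_or eq_sym => /andP[ko oks].
by apply: IHks => //; apply: extends_gmut.
Qed.

(** A vertex [o] at which no mutation takes place contributes no negative power.
    Join it to a new vertex with variable [w]. The element is reached both from the
    initial cluster and from its mutation at [o], hence is a polynomial in [vr S o]
    and in its neighbour [(A w + C) / vr S o]; now set [w] to [- C / A]. *)
Lemma laurent_frozen S ks k o : good S -> o \notin ks ->
  laurent_pos S (pred1 o) (vr (foldl gmut S ks) k).
Proof.
move=> gS oks; set f := vr _ k.
set T := extend S o; have gT : good T by apply: good_extend.
have ext : extends o T S.
  by split=> // a neao /=; rewrite (negbTE neao).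
have gf : vr (foldl gmut T (map Some ks)) (Some k) = cst f.
  by case: (extends_foldl ext oks) => _ -> _.
have T1 : laurent T (cst f) by rewrite -gf; apply: laurent_phenomenon.
have T2 : laurent (gmut T (Some o)) (cst f).
  rewrite -gf -{2}(gmutK (Some o) gT).
  apply: (@laurent_phenomenon _ _ (gmut T (Some o)) (Some o :: map Some ks)).
  exact: good_gmut.
have neq : Some o != None by [].
have := laurent_one_mutable gT neq T1 T2.
pose A := \prod_a vr S a ^+ natpos (mx S a o).
pose C := \prod_a vr S a ^+ natpos (- mx S a o).
have [sk iS _] := gS.
have A0 : A != 0 by apply: monomial_neq0.
have C0 : C != 0 by apply: monomial_neq0.
have PoE : expol T (Some o) = var F * cst A + cst C.
  rewrite /expol !prod_option /= eqxx expr0 mul1r expr1 /A /C !rmorph_prod.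
  by congr (_ * _ + _); apply: eq_bigr => a _; rewrite rmorphXn.
pose H := laurent_pos S (pred1 o); have sH : is_subring H := laurent_pos_is_subring S _.
have HA (e : I -> nat) : e o = 0%N -> H (\prod_a vr S a ^+ e a) /\
    H (\prod_a vr S a ^+ e a)^-1.
  move=> eo; split; apply: (subring_gen_sub sH (G := H)) => //.
    by apply: gen_monomial => a _ _; apply: mem_subring_gen; apply: laurent_pos_vr.
  rewrite -prodfV; under eq_bigr do rewrite -exprVn.
  apply: (@gen_monomial I _ _ _ (fun a => (vr S a)^-1)) => a _ ea0.
  apply: mem_subring_gen; apply: laurent_pos_vrV => /=.
  by apply: contra_neq ea0 => ->.
have [HA1 HAV] := HA (fun a => natpos (mx S a o)) (congr1 natpos (skew_diag o sk)).
have [HC1 HCV] : H C /\ H C^-1 by apply: (HA (fun a => natpos (- mx S a o))); rewrite skew_diag.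
pose c := - (C / A); have c0 : c != 0 by rewrite oppr_eq0 mulf_neq0 ?invr_eq0.
have Hc : H c by apply: (subringN sH); apply: (subringM sH).
have HcV : H c^-1.
  by rewrite invrN invf_div; apply: (subringN sH); apply: (subringM sH).
have spec_but y : laurent_but T (Some o) None y -> exists2 x, H x & specialises c y x.
  move=> Ty; have [|x Hx yx] := @specialises_gen F c _ H y _ Ty; last first.
    by exists x => //; apply: subring_gen_sub Hx.
  move=> z [[[a|] [ao _ za]] //|/=].
    case: za => ->; [exists (vr S a)|exists (vr S a)^-1].
    - exact: laurent_pos_vr.
    - exact: specialises_cst.
    - by apply: laurent_pos_vrV; apply: contra_neq ao => ->.
    - by apply: specialisesV; [apply: independent_neq0|apply: specialises_cst].
  rewrite !inE => /orP[] /eqP ->; first by exists c => //; apply: specialises_var.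
  by exists c^-1 => //; apply: specialisesV => //; apply: specialises_var.
move=> Tf; have [|x Hx fx] := @specialises_gen F c _ H _ _ Tf; last first.
  have -> : f = x by apply: specialises_fun fx; apply: specialises_cst.
  exact: subring_gen_sub Hx.
move=> z [/spec_but //|/=]; rewrite !inE => /orP[] /eqP ->.
  by exists (vr S o); [apply: laurent_pos_vr|apply: specialises_cst].
exists 0; first exact: (subring0 sH).
have -> : 0 = (c * A + C) / vr S o by rewrite /c mulNr divfK // addNr mul0r.
rewrite PoE; apply: specialises_div; first exact: independent_neq0.
  apply: specialisesD; last exact: specialises_cst.
  by apply: specialisesM; [apply: specialises_var|apply: specialises_cst].
exact: specialises_cst.
Qed.

(** By uniqueness of expansions the inverses of the variables in [r] can be removed
    one after the other. *)
Lemma laurent_pos_mem S ks k (r : seq I) : good S ->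
  (forall o, o \in r -> o \notin ks) ->
  laurent_pos S (mem r) (vr (foldl gmut S ks) k).
Proof.
move=> gS; set f := vr _ k; elim: r => [_|o r IHr ror].
  apply: (subring_gen_sub (laurent_pos_is_subring S _) _ (laurent_phenomenon ks k gS)).
  by move=> x [a [|] ->]; [apply: laurent_pos_vr|apply: laurent_pos_vrV].
have fr : laurent_pos S (mem r) f.
  by apply: IHr => a ar; apply: ror; rewrite inE ar orbT.
have fo : laurent_pos S (pred1 o) f by apply: laurent_frozen => //; apply: ror; rewrite inE eqxx.
have [or|nor] := boolP (o \in r).
  apply: (subring_gen_sub (laurent_pos_is_subring S _) _ fr) => x [a [->|[ra ->]]].
    exact: laurent_pos_vr.
  by apply: laurent_pos_vrV; rewrite inE negb_or ra andbT; apply: contraNneq ra => ->.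
pose G : set F := [set x | exists a, a != o /\ (x = vr S a \/ (a \notin r /\ x = (vr S a)^-1))].
pose G' : set F := [set x | exists a, a != o /\ (x = vr S a \/ x = (vr S a)^-1)].
have sG := subring_gen_is_subring G; have sG' := subring_gen_is_subring G'.
have GG' y : subring_gen G y -> subring_gen G' y.
  apply: subring_genS => x [a [ao xa]]; apply: mem_subring_gen; exists a; split=> //.
  by case: xa => [->|[_ ->]]; [left|right].
have to : transcendental (subring_gen G') (vr S o).
  apply: transcendental_vr => //.
  apply: (subring_gen_sub (fractions_others_is_subring S o)) => x [a [ao xa]].
  by case: xa => ->; [|apply: fractions_othersV]; apply: fractions_vr.
have : adjoin (subring_gen G) [:: vr S o] f.
  apply: (laurent_polynomial sG sG' GG' to).
    apply: (subring_gen_sub (adjoin_is_subring _ _) _ fr) => x [a xa].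
    have [eao|nao] := eqVneq a o.
      by case: xa => [|[_]] ->; rewrite eao; apply: adjoin_mem; rewrite !inE eqxx ?orbT.
    apply: adjoin_base; apply: mem_subring_gen; exists a.
    by case: xa => [->|[nar ->]]; split=> //; [left|right].
  apply: (subring_gen_sub (adjoin_is_subring _ _) _ fo) => x [a xa].
  have [eao|nao] := eqVneq a o.
    case: xa => [->|[/= nao _]]; last by rewrite eao eqxx in nao.
    by rewrite eao; apply: adjoin_mem; rewrite inE.
  apply: adjoin_base; apply: mem_subring_gen; exists a.
  by case: xa => [->|[_ ->]]; split=> //; [left|right].
apply: (adjoin_sub (laurent_pos_is_subring S _)); last first.
  by move=> x; rewrite inE => /eqP ->; apply: laurent_pos_vr.
apply: (subring_gen_sub (laurent_pos_is_subring S _)) => x [a [ao [->|[ar ->]]]].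
  exact: laurent_pos_vr.
by apply: laurent_pos_vrV; rewrite inE negb_or ao.
Qed.

End Frozen.

(** * Independence of the initial cluster and the frozen variables *)

Section GroupRing.

Import monalg.

Lemma trop_val_free (F : fieldType) (m : nat) (z : 'I_m -> F) (r : seq (trop m))
    (c : trop m -> int) : contains_group_ring z -> uniq r ->
  \sum_(a <- r) (c a)%:~R * trop_val z a = 0 -> forall a, a \in r -> c a = 0.
Proof.
move=> inj ur r0 a ar.
pose g : {malg int[trop m]} := \sum_(a <- r) << c a *g a >>.
have g0 : g = 0.
  apply: inj; rewrite /group_ring_val /g !raddf_sum /= raddf0 -[RHS]r0.
  by apply: eq_bigr => b _; rewrite mmapU.
have := congr1 (mcoeff a) g0; rewrite raddf0 /g raddf_sum /= (bigD1_seq a) //=.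
rewrite mcoeffU eqxx mulr1n big1 ?addr0 // => b neba.
by rewrite mcoeffU (negbTE neba).
Qed.

Lemma ZP_sum (F : fieldType) (m : nat) (z : 'I_m -> F) (r : seq (trop m))
    (c : trop m -> int) : ZP z (\sum_(a <- r) (c a)%:~R * trop_val z a).
Proof.
exists (\sum_(a <- r) << c a *g a >>) => //.
rewrite /group_ring_val raddf_sum /=; apply: eq_bigr => b _; exact: mmapU.
Qed.

End GroupRing.

Section InitialIndependence.

Variable F : fieldType.

(** The polynomials not involving ['X_i] are those which a substitution of ['X_i]
    by a new variable sends to constants. *)
Lemma transcendental_mmap (K : comNzRingType) (phi : {rmorphism K -> F}) (n : nat)
    (x : 'I_n -> F) (i : 'I_n) :
  (forall p : {mpoly K[n]}, mmap phi x p = 0 -> p = 0) ->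
  transcendental (subring_gen (range phi `|` others x i)) (x i).
Proof.
move=> inj p Ep px0.
pose h (j : 'I_n) : {poly {mpoly K[n]}} := if j == i then 'X else ('X_j)%:P.
pose s := mmap (polyC \o @mpolyC n K) h.
pose A : set F := [set f | exists q : {mpoly K[n]}, s q = q%:P /\ mmap phi x q = f].
have sA : is_subring A.
  apply: is_subringP; split.
  - by exists 1; split; rewrite /s rmorph1.
  - move=> _ _ [q [sq <-]] [r [sr <-]]; exists (q - r); split.
      by rewrite polyCB -sq -sr /s rmorphB.
    by rewrite rmorphB.
  - move=> _ _ [q [sq <-]] [r [sr <-]]; exists (q * r); split.
      by rewrite polyCM -sq -sr /s rmorphM.
    by rewrite rmorphM.
have /choice[q qP] (d : nat) :
    exists q : {mpoly K[n]}, s q = q%:P /\ mmap phi x q = p`_d.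
  apply: (subring_gen_sub sA _ (Ep d)) => _ [[c _ <-]|[j neji ->]].
    by exists c%:MP; rewrite /s !mmapC.
  by exists 'X_j; rewrite /s !mmapX !mmap1U /h (negbTE neji).
pose P := \sum_(d < size p) q d * 'X_i ^+ d.
have P0 : P = 0.
  apply: inj; rewrite /P rmorph_sum -[RHS]px0 horner_coef; apply: eq_bigr => d _.
  by rewrite rmorphM rmorphXn /= mmapX mmap1U; case: (qP d) => _ ->.
have : s P = \poly_(d < size p) q d.
  rewrite poly_def /s /P rmorph_sum; apply: eq_bigr => d _.
  rewrite rmorphM rmorphXn /= mmapX mmap1U /h eqxx -/h -/s.
  by case: (qP d) => -> _; rewrite mul_polyC.
rewrite P0 /s rmorph0 => /esym q0.
apply/polyP => d; rewrite coef0; have [ltd|led] := ltnP d (size p); last first.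
  exact: nth_default.
have := congr1 (fun r : {poly {mpoly K[n]}} => r`_d) q0.
rewrite coef_poly ltd coef0 => qd0.
by case: (qP d) => _ <-; rewrite qd0 rmorph0.
Qed.

(** Monomials with natural exponents are elements of the tropical group. *)
Lemma mmap_trop (m : nat) (z : 'I_m -> F) (p : {mpoly int[m]}) :
  exists (r : seq (trop m)) (c : trop m -> int),
    [/\ mmap intr z p = \sum_(a <- r) (c a)%:~R * trop_val z a, uniq r
       & (forall a, a \in r -> c a = 0) -> p = 0].
Proof.
pose t (a : 'X_{1..m}) : trop m := [ffun i => (a i)%:Z].
pose t' (b : trop m) : 'X_{1..m} := [multinom natpos (b i) | i < m].
have tK : cancel t t' by move=> a; apply/mnmP => i; rewrite mnmE ffunE.
exists (map t (msupp p)), (fun b => p@_(t' b)); split.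
- rewrite big_map /mmap; apply: eq_bigr => a _; rewrite tK.
  by congr (_ * _); apply: eq_bigr => i _; rewrite ffunE.
- by rewrite map_inj_uniq ?msupp_uniq //; apply: can_inj tK.
- move=> c0; apply/mpolyP => a; rewrite mcoeff0.
  have [ap|/memN_msupp_eq0 //] := boolP (a \in msupp p).
  by have := c0 _ (map_f t ap); rewrite tK.
Qed.

Lemma mmap_inj0 (m : nat) (z : 'I_m -> F) : contains_group_ring z ->
  forall p : {mpoly int[m]}, mmap intr z p = 0 -> p = 0.
Proof.
move=> inj p; have [r [c [-> ur c0]]] := mmap_trop z p.
by move=> /(trop_val_free inj ur)/c0.
Qed.

Lemma mmap_frac_ZP (m : nat) (z : 'I_m -> F) (p : {mpoly int[m]}) :
  frac_ZP z (mmap intr z p).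
Proof.
exists (mmap intr z p); first by have [r [c [-> _ _]]] := mmap_trop z p; apply: ZP_sum.
exists 1; last by rewrite divr1.
have := ZP_sum z [:: 0] (fun=> 1); rewrite big_seq1 mul1r.
by congr (ZP z _); apply: big1 => i _; rewrite ffunE.
Qed.

(** The elements [x i] are added one at a time, with [transcendental_exchange]. *)
Lemma transcendental_extend (G : set F) (n : nat) (x : 'I_n -> F) (a : F) :
  transcendental (subring_gen G) a ->
  (forall i, transcendental (subring_gen (G `|` [set a] `|` others x i)) (x i)) ->
  transcendental (subring_gen (G `|` range x)) a.
Proof.
move=> ta tx.
pose Gk k : set F := G `|` [set f | exists2 i : 'I_n, (i < k)%N & f = x i].
have step k : (k <= n)%N -> transcendental (subring_gen (Gk k)) a.
  elim: k => [_|k IHk ltkn].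
    by apply: transcendentalS ta => y; apply: subring_genS => f [/mem_subring_gen|[]].
  pose i := Ordinal ltkn.
  apply: (@transcendentalS _ (adjoin (Gk k) [:: x i])).
    move=> y; apply: (subring_gen_sub (adjoin_is_subring _ _)) => f [Gf|[j]].
      by apply: adjoin_base; left.
    rewrite ltnS leq_eqVlt => /orP[/eqP jk ->|ltjk ->].
      have -> : j = i by apply: val_inj.
      by apply: adjoin_mem; rewrite inE.
    by apply: adjoin_base; right; exists j.
  apply: transcendental_exchange; first exact: IHk (ltnW ltkn).
  apply: transcendentalS (tx i).
  apply: (adjoin_sub (subring_gen_is_subring _)) => f.
    move=> [Gf|[j ltjk ->]]; apply: mem_subring_gen; first by left; left.
    right; exists j => //; apply/eqP => ji.
    by move: ltjk; rewrite ji ltnn.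
  by rewrite inE => /eqP ->; apply: mem_subring_gen; left; right.
apply: transcendentalS (step n (leqnn n)) => y.
apply: subring_genS => f [Gf|[i _ <-]]; apply: mem_subring_gen; first by left.
by right; exists i.
Qed.

Definition all_vars (n m : nat) (z : 'I_m -> F) (x : 'I_n -> F) (v : 'I_n + 'I_m) : F :=
  match v with inl i => x i | inr j => z j end.

(** The cluster is independent over the polynomials in [z], and the frozen variables
    are independent over the integers; [transcendental_extend] combines the two. *)
Lemma independent_all_vars (n m : nat) (z : 'I_m -> F) (x : 'I_n -> F) :
  contains_group_ring z -> alg_independent (frac_ZP z) x ->
  independent (all_vars z x).
Proof.
move=> hZP hx; have injz := mmap_inj0 hZP.
pose phi : {rmorphism {mpoly int[m]} -> F} := mmap intr z.
have injx (p : {mpoly {mpoly int[m]}[n]}) : mmap phi x p = 0 -> p = 0.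
  move=> p0; have /mpolyP pm0 : map_mpoly phi p = 0.
    apply: hx.
      rewrite qualifE /=; apply/allP => _ /mapP[a _ ->].
      by rewrite inE mcoeff_map_mpoly; apply: mmap_frac_ZP.
    rewrite -[RHS]p0 (map_mpolyE _ (leqnn (msize p))) (mmapE _ (leqnn (msize p))).
    rewrite raddf_sum /=; apply: eq_bigr => a _.
    by rewrite mevalZ mevalX.
  apply/mpolyP => a; rewrite mcoeff0; apply: injz.
  by have := pm0 a; rewrite mcoeff_map_mpoly mcoeff0.
have phiz j : phi 'X_j = z j by rewrite /= mmapX mmap1U.
have tx i := @transcendental_mmap _ phi n x i injx.
have tz j := @transcendental_mmap int intr m z j injz.
case=> [i|j] /=.
  apply: transcendentalS (tx i) => y; apply: subring_genS => f [[k|k] neki ->] /=.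
    by apply: mem_subring_gen; right; exists k.
  by rewrite -phiz; apply: mem_subring_gen; left; exists 'X_k.
apply: (@transcendentalS _ (subring_gen (others z j `|` range x))).
  move=> y; apply: subring_genS => f [[k|k] nekj ->] /=; apply: mem_subring_gen.
    by right; exists k.
  by left; exists k.
apply: transcendental_extend.
  by apply: transcendentalS (tz j) => y; apply: subring_genS => f ?; apply: mem_subring_gen; right.
move=> i; apply: transcendentalS (tx i) => y; apply: subring_genS => f.
move=> [[[k _ ->]|->]|?]; last by apply: mem_subring_gen; right.
  by rewrite -phiz; apply: mem_subring_gen; left; exists 'X_k.
by rewrite -phiz; apply: mem_subring_gen; left; exists 'X_j.
Qed.

Lemma char_neq2 (m : nat) (z : 'I_m -> F) : contains_group_ring z -> (2%:R : F) != 0.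
Proof.
move=> hZP; apply/eqP => two0.
have := mmap_inj0 hZP (p := 2%:MP); rewrite mmapC => /(_ two0) /eqP.
by rewrite mpolyC_eq0.
Qed.

End InitialIndependence.

(** * Seeds as square matrices *)

Lemma half_mutation_term (a b : int) :
  ((`|a| * b + a * `|b|) %/ 2)%Z = mutation_term a b.
Proof.
suff -> : `|a| * b + a * `|b| = mutation_term a b * 2 by rewrite mulzK.
by rewrite /mutation_term; case: a b => [[|a]|a] [[|b]|b] /=; lia.
Qed.

Section Represent.

Variables (F : fieldType) (n m : nat) (z : 'I_m -> F).

Local Notation vertex := ('I_n + 'I_m)%type.

Definition represents (G : gseed vertex F) (S : seed_data F n m) : Prop :=
  [/\ good G,
      forall a b, mx G (inl a) (inl b) = exchange_matrix S a b,
      forall j b, mx G (inr j) (inl b) = coefficients S b j,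
      forall a, vr G (inl a) = cluster S a
    & forall j, vr G (inr j) = z j].

Lemma trop_mulrz (a : trop m) (c : int) j : (a *~ c) j = a j *~ c.
Proof.
have nat_case (N : nat) : (a *+ N) j = a j *+ N.
  by elim: N => [|N IHN]; rewrite ?mulr0n ?mulrS ?ffunE ?IHN.
by case: c => N; rewrite ?NegzE ?mulrNz -?pmulrn ?ffunE nat_case.
Qed.

(** Dividing by [y (+) 1] brings the coefficients into lowest terms: [y / (y (+) 1)]
    and [1 / (y (+) 1)] are the products of the frozen variables with positive,
    respectively negative, exponents in [y]. *)
Lemma expol_represents G S k : represents G S ->
  expol G (inl k) =
    (trop_val z (coefficients S k)
       * \prod_(j < n) cluster S j ^ pos_part (exchange_matrix S j k)
     + \prod_(j < n) cluster S j ^ pos_part (- exchange_matrix S j k))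
    / trop_val z (trop_oplus (coefficients S k) 0).
Proof.
move=> [gG GB Gy Gx Gz].
have z0 j : z j != 0 by rewrite -Gz vr_neq0.
set y := coefficients S k.
have T0 : trop_val z (trop_oplus y 0) != 0.
  by rewrite prodf_seq_neq0; apply/allP => j _; rewrite expfz_neq0.
have xB (c : int -> int) : \prod_a vr G (inl a) ^+ natpos (c (mx G (inl a) (inl k)))
    = \prod_(j < n) cluster S j ^ pos_part (c (exchange_matrix S j k)).
  by apply: eq_bigr => a _; rewrite Gx GB /pos_part -natposE.
have zy (c : trop m) (c' : int -> int) :
    (forall j, c j = Num.min (y j) 0 + (natpos (c' (y j)))%:Z) ->
    trop_val z c = trop_val z (trop_oplus y 0)
      * \prod_j vr G (inr j) ^+ natpos (c' (mx G (inr j) (inl k))).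
  move=> cE; rewrite /trop_val -big_split; apply: eq_bigr => j _ /=.
  by rewrite cE expfzDr // !ffunE Gz Gy.
rewrite /expol !big_sumType /= (xB id) (xB -%R) mulrDl (zy y id); last first.
  by move=> j; rewrite natposE; lia.
have E : \prod_j vr G (inr j) ^+ natpos (- mx G (inr j) (inl k))
    = (trop_val z (trop_oplus y 0))^-1.
  apply: (mulfI T0); rewrite mulfV // -(zy 0 -%R); last first.
    by move=> j; rewrite natposE ffunE; lia.
  by apply: big1 => j _; rewrite ffunE.
by rewrite E; congr (_ + _); field.
Qed.

Lemma represents_mutate G S k : represents G S ->
  represents (gmut G (inl k)) (mutate z S k).
Proof.
move=> GSrep; have [gG GB Gy Gx Gz] := GSrep; split; first exact: good_gmut.
- move=> a b; rewrite /= mxE half_mutation_term !GB.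
  by rewrite !(inj_eq inl_inj).
- move=> j b; rewrite /= ffunE (_ : (inl b == inl k) = (b == k)) //.
  case: eqP => [->|_]; first by rewrite ffunE Gy.
  rewrite !ffunE !trop_mulrz ffunE !Gy GB /mutation_term /pos_part.
  rewrite ffunE.
  move: (coefficients S b j) (coefficients S k j) (exchange_matrix S k b) => y u b'.
  by case: u b' => [[|u]|u] [[|b']|b'] /=; lia.
- move=> a; rewrite /= ffunE (_ : (inl a == inl k) = (a == k)) //.
  case: eqP => // _; rewrite Gx (expol_represents _ GSrep).
  by rewrite -mulrA -invfM.
- exact: Gz.
Qed.

Lemma represents_foldl G S ks : represents G S ->
  represents (foldl gmut G (map inl ks)) (foldl (mutate z) S ks).
Proof.
elim: ks G S => //= k ks IHks G S GS; apply: IHks; exact: represents_mutate.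
Qed.

Lemma ZPplus_z j : ZPplus z (z j).
Proof. by exists 'X_j => //; rewrite mmapX mmap1U. Qed.

Lemma subring_int (E : set F) (c : int) : is_subring E -> E c%:~R.
Proof.
move=> sE; have nat_case N : E N%:R.
  elim: N => [|N IHN]; first exact: subring0.
  by rewrite -addn1 natrD; apply: subringD => //; apply: subring1.
case: c => N; first exact: nat_case.
by rewrite NegzE mulrNz; apply: subringN => //; apply: nat_case.
Qed.

Lemma ZPplus_sub (E : set F) : is_subring E -> (forall j, E (z j)) ->
  forall f, ZPplus z f -> E f.
Proof.
move=> sE Ez _ [p _ <-]; apply: subring_sum => // a _; apply: subringM => //.
  exact: subring_int.
by apply: subring_prod => // j _; apply: subringX.
Qed.

Definition frozen : seq vertex := map inr (enum 'I_m).

Lemma frozen_inl k : inl k \in frozen = false.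
Proof. by apply/negP => /mapP[]. Qed.

Lemma frozen_inr j : inr j \in frozen.
Proof. by rewrite map_f ?mem_enum. Qed.

Lemma laurent_ring_represents G S : represents G S ->
  laurent_ring (ZPplus z) (cluster S) = laurent_pos G (mem frozen).
Proof.
move=> [_ _ _ Gx Gz]; apply/seteqP; split=> f.
  apply: (subring_gen_sub (laurent_pos_is_subring _ _)) => x [[|]|].
  - apply: (ZPplus_sub (laurent_pos_is_subring _ _)) => j; rewrite -Gz.
    exact: laurent_pos_vr.
  - by move=> [a _ <-]; rewrite -Gx; apply: laurent_pos_vr.
  - by move=> [a _ <-]; rewrite -Gx; apply: laurent_pos_vrV; rewrite /= frozen_inl.
apply: (subring_gen_sub (subring_gen_is_subring _)) => x [[a|j]] [->|[af ->]].
- by apply: mem_subring_gen; left; right; exists a; rewrite ?Gx.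
- by apply: mem_subring_gen; right; exists a; rewrite ?Gx.
- by apply: mem_subring_gen; left; left; rewrite Gz; apply: ZPplus_z.
- by rewrite /= frozen_inr in af.
Qed.

(** Any cluster of the class may serve as the initial one, by reversing the
    mutations which lead to it. *)
Lemma cluster_algebra_sub_upper G S : represents G S ->
  cluster_algebra z (ZPplus z) S `<=` upper_cluster_algebra z (ZPplus z) S.
Proof.
move=> GS f Af _ [ks [s ->]].
have GS' := represents_foldl ks GS; set S1 := foldl (mutate z) S ks in GS' *.
have -> : laurent_ring (ZPplus z) (cluster (permute_seed s S1))
        = laurent_ring (ZPplus z) (cluster S1).
  congr (subring_gen (_ `|` _ `|` _)); apply/seteqP; split=> x [a _ <-].
  - by exists (s a); rewrite //= ffunE.
  - by exists ((s^-1)%g a); rewrite //= ffunE permKV.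
  - by exists (s a); rewrite //= ffunE.
  - by exists ((s^-1)%g a); rewrite //= ffunE permKV.
have [gG _ _ _ _] := GS; have [gG' _ _ _ _] := GS'.
apply: (subring_gen_sub _ _ Af); first exact: subring_gen_is_subring.
move=> x [Zx|[_ [[ks' [s' ->]]]] [a _ <-]].
  by apply: mem_subring_gen; left; left.
have GS'' := represents_foldl ks' GS; have [_ _ _ Gx _] := GS''.
rewrite (laurent_ring_represents GS') /= ffunE -Gx.
have -> : foldl gmut G (map inl ks') = foldl gmut (foldl gmut G (map inl ks))
    (rev (map inl ks) ++ map inl ks') by rewrite foldl_cat foldl_gmutK.
apply: laurent_pos_mem => // o /mapP[j _ ->].
rewrite mem_cat mem_rev negb_or; apply/andP; split; apply/negP => /mapP[] //.
Qed.

End Represent.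

(** * The upper bound for an acyclic set of mutable vertices *)

Section LowerBound.

Variables (I : finType) (F : fieldType) (Z : pred I).
Implicit Types (S : gseed I F) (T W D : {set I}) (i j k : I).

Local Notation no_vertex := (@finset.set0 I).

Definition neighbour S k : F := expol S k / vr S k.

(** With [W] empty, this is the Laurent ring of the cluster obtained by mutating at
    the pairwise unjoined vertices of [D]; with [D] empty, it is the lower bound
    algebra with [W] as set of mutable vertices. The variables of [Z] are not
    inverted in either case. *)
Definition mixed_ring S W D : set F :=
  subring_gen [set f | exists a,
    [\/ a \notin D /\ f = vr S a,
        [/\ a \notin W, a \notin D, ~~ Z a & f = (vr S a)^-1],
        (a \in W) || (a \in D) /\ f = neighbour S a
      | a \in D /\ f = (neighbour S a)^-1]].

Lemma mixed_ring_is_subring S W D : is_subring (mixed_ring S W D).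
Proof. exact: subring_gen_is_subring. Qed.

Definition isolated S T : Prop := forall k l, k \in T -> l \in T -> mx S k l = 0.

(** Mutations at unjoined vertices do not interact. *)
Lemma expol_isolated_gmut S T k l : isolated S T -> k \in T -> l \in T -> l != k ->
  expol (gmut S k) l = expol S l.
Proof.
move=> iso kT lT nelk; have kl : mx S k l = 0 by apply: iso.
have col a : mx (gmut S k) a l = mx S a l.
  rewrite /= (negbTE nelk) orbF; case: eqP => [->|_]; first by rewrite kl oppr0.
  by rewrite kl /mutation_term !muln0 addr0.
rewrite /expol; congr (_ + _); apply: eq_bigr => a _; rewrite col /=;
  by case: eqP => // ->; rewrite kl !expr0.
Qed.

Lemma vr_isolated_foldl S T ks a : isolated S T -> uniq ks ->
  (forall k, k \in ks -> k \in T) ->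
  vr (foldl gmut S ks) a = if a \in ks then neighbour S a else vr S a.
Proof.
elim: ks S => //= k ks IHks S iso /andP[kks uks] ksT.
have kT : k \in T by apply: ksT; rewrite inE eqxx.
have ksT' l : l \in ks -> l \in T by move=> lks; apply: ksT; rewrite inE lks orbT.
have iso' : isolated (gmut S k) T.
  move=> c d cT dT /=; rewrite (iso c d) // (iso c k) // (iso k d) //.
  by case: (_ || _).
rewrite (IHks _ iso' uks ksT') inE; case: ifP => [aks|naks].
  rewrite orbT; have neak : a != k by apply: contraNneq kks => <-.
  rewrite /neighbour (expol_isolated_gmut iso) //; last exact: ksT'.
  by rewrite /= (negbTE neak).
by rewrite orbF /=; case: eqP => // ->.
Qed.

(** The vertices are moved one at a time to [W]: if [f] is in the ring with [k]
    unchanged and in the ring with [k] mutated, [laurent_exchange] places it in the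
    ring with both [vr S k] and its neighbour. *)
Lemma isolated_mixed_ring S T f : good S -> isolated S T ->
  (forall a, a \in T -> ~~ Z a) ->
  (forall ks, (forall k, k \in ks -> k \in T) ->
     laurent_pos (foldl gmut S ks) Z f) ->
  mixed_ring S T no_vertex f.
Proof.
move=> gS iso TZ Uf; have [sk _ _] := gS.
suff all W D : W \subset T -> D \subset T -> [disjoint W & D]%B -> mixed_ring S W D f.
  by apply: all; rewrite ?finset.sub0set //; apply/pred0P => x; rewrite !inE andbF.
have [N] := ubnP #|W|; elim: N W D => // N IHN W D leN WT DT WD.
have [W0|[k kW]] := finset.set_0Vmem W.
  have eDT l : l \in enum D -> l \in T by rewrite mem_enum; apply: (fintype.subsetP DT).
  have DE a := vr_isolated_foldl a iso (enum_uniq D) eDT.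
  apply: (subring_gen_sub (mixed_ring_is_subring _ _ _) _ (Uf (enum D) eDT)).
  move=> x [a]; rewrite DE mem_enum.
  case: ifP => aD [->|[Za ->]]; apply: mem_subring_gen; exists a.
  - by apply: Or43; rewrite aD orbT.
  - exact: Or44.
  - by apply: Or41; rewrite aD.
  - by apply: Or42; rewrite W0 inE aD.
have kT : k \in T by apply: (fintype.subsetP WT).
have kD : k \notin D by rewrite (disjointFr WD).
pose E0 : set F := [set x | exists2 a, a != k &
    [\/ a \notin D /\ x = vr S a,
        [/\ a \notin W, a \notin D, ~~ Z a & x = (vr S a)^-1],
        (a \in W) || (a \in D) /\ x = neighbour S a
      | a \in D /\ x = (neighbour S a)^-1]].
pose E := subring_gen E0; have sE : is_subring E := subring_gen_is_subring E0.
have fk : adjoin E [:: vr S k; neighbour S k] f.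
  apply: (laurent_exchange sE sE) => //.
  - apply: transcendental_vr => //; have sF := fractions_others_is_subring S k.
    have nb a : (a \in W) || (a \in D) -> a != k ->
        fractions (subring_gen (others (vr S) k)) (neighbour S a).
      move=> aWD neak; have aT : a \in T.
        by case/orP: aWD => ?; [apply: (fintype.subsetP WT)|apply: (fintype.subsetP DT)].
      apply: (subringM sF); last by apply: fractions_othersV; apply: fractions_vr.
      apply: (sub_fractions (subring_gen_is_subring _)).
      have nb b : mx S b a != 0 -> subring_gen (others (vr S) k) (vr S b).
        move=> ba; apply: mem_subring_gen; exists b => //.
        by apply: contraNneq ba => ->; rewrite iso.
      apply: (subringD (subring_gen_is_subring _)); apply: gen_monomial => b _ e0;
        by apply: nb; apply: contra_neq e0 => ->.
    apply: (subring_gen_sub sF) => x [a neak].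
    case=> [[_ ->]|[_ _ _ ->]|[aWD ->]|[aD ->]].
    + exact: fractions_vr.
    + by apply: fractions_othersV; apply: fractions_vr.
    + exact: nb.
    + by apply: fractions_othersV; apply: nb => //; rewrite aD orbT.
  - have nb a : mx S a k != 0 -> E (vr S a).
      move=> ak; apply: mem_subring_gen; exists a.
        by apply: contraNneq ak => ->; rewrite skew_diag.
      apply: Or41; split=> //; apply: contra ak => aD; rewrite iso //.
      exact: (fintype.subsetP DT).
    apply: (subringD sE); apply: gen_monomial => a _ e0;
      by apply: nb; apply: contra_neq e0 => ->.
  - exact: expol_neq0.
  - have := IHN (W :\ k) D; rewrite (finset.cardsD1 k W) kW in leN.
    move=> /(_ leN (fintype.subset_trans (finset.subsetDl _ _) WT) DT) fW.
    apply: (subring_gen_sub (adjoin_is_subring _ _) _ (fW _)); last first.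
      by apply: disjointWl WD; apply: finset.subsetDl.
    move=> x [a ax]; have [eak|neak] := eqVneq a k.
      case: ax => [[_ ->]|[_ _ _ ->]|[]|[]]; rewrite eak ?(negbTE kD) ?inE ?eqxx //.
        by apply: adjoin_mem; rewrite inE eqxx.
      by apply: adjoin_mem; rewrite !inE eqxx orbT.
    apply: adjoin_base; apply: mem_subring_gen; exists a => //.
    by move: ax; rewrite !inE neak.
  - have := IHN (W :\ k) (k |: D); rewrite (finset.cardsD1 k W) kW in leN.
    have kDT : k |: D \subset T by rewrite finset.subUset finset.sub1set kT.
    move=> /(_ leN (fintype.subset_trans (finset.subsetDl _ _) WT) kDT) fW.
    apply: (subring_gen_sub (adjoin_is_subring _ _) _ (fW _)); last first.
      apply/pred0P => x; rewrite /= !inE; case: (x == k) => //=.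
      by case: (boolP (x \in W)) => //= xW; rewrite (disjointFr WD).
    move=> x [a ax]; have [eak|neak] := eqVneq a k.
      rewrite eak !inE eqxx /= in ax; case: ax => [[]|[]|[_ ->]|[_ ->]] //.
        by apply: adjoin_mem; rewrite inE eqxx.
      by apply: adjoin_mem; rewrite !inE eqxx orbT.
    apply: adjoin_base; apply: mem_subring_gen; exists a => //.
    by move: ax; rewrite !inE (negbTE neak).
apply: (adjoin_sub (mixed_ring_is_subring S W D) _ _ fk).
  by move=> x; apply: subring_genS => y [a _ ay]; apply: mem_subring_gen; exists a.
move=> x; rewrite !inE => /orP[] /eqP ->; apply: mem_subring_gen; exists k.
  exact: Or41.
by apply: Or43; rewrite kW.
Qed.

(** The function [rho] witnesses acyclicity: a vertex [i] at which it is minimal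
    among those with an arrow to some [j] in [T] is a source of [T]. In the exchange
    relation at [i] one monomial is a multiple of the variable of [j] and the other
    one involves only invertible variables, so that the variables of [i] and [j]
    generate the unit ideal; for each of them, the induction hypothesis with this
    vertex removed from [T] clears a power of it. *)
Lemma mixed_ring_source S T (rho : I -> nat) f : good S ->
  (forall a, a \in T -> ~~ Z a) ->
  (forall o i, Z o -> i \in T -> 0 <= mx S o i) ->
  (forall i j, i \in T -> j \in T -> 0 < mx S j i -> (rho i < rho j)%N) ->
  (forall ks, (forall k, k \in ks -> k \in T) ->
     laurent_pos (foldl gmut S ks) Z f) ->
  mixed_ring S T no_vertex f.
Proof.
move=> gS; have [sk _ _] := gS.
have [N] := ubnP #|T|; elim: N T => // N IHN T leN TZ srcT rhoT Uf.
pose tail i := (i \in T) && [exists j, (j \in T) && (0 < mx S j i)].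
have [i0 ti0|none] := pickP tail; last first.
  apply: isolated_mixed_ring => // k l kT lT.
  have nlt i j : i \in T -> j \in T -> (0 < mx S j i) = false.
    move=> iT jT; apply/negP => ji; have := none i; rewrite /tail iT /= => /existsP.
    by apply; exists j; rewrite jT.
  by have := nlt k l kT lT; have := nlt l k lT kT; rewrite (sk l k); lia.
case: (arg_minnP rho ti0) => i /andP[iT /existsP[j /andP[jT ji]]] imin.
have src l : l \in T -> (0 < mx S i l) = false.
  move=> lT; apply/negP => il.
  have := imin l; rewrite /tail lT /= => /(_ _).
  have /[swap] /[apply] : [exists j0, (j0 \in T) && (0 < mx S j0 l)].
    by apply/existsP; exists i; rewrite iT.
  by have := rhoT l i lT iT il; lia.
pose A := mixed_ring S T no_vertex; have sA : is_subring A := mixed_ring_is_subring S T _.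
have Avr a : A (vr S a) by apply: mem_subring_gen; exists a; apply: Or41; rewrite inE.
have clear k : k \in T -> exists M, A (f * vr S k ^+ M).
  move=> kT; apply: (adjoinV_clear sA (Avr k) (vr_neq0 k gS)).
  have fk : mixed_ring S (T :\ k) no_vertex f.
    apply: IHN => [|a|o l Zo|a b|ks ksT].
    - by rewrite (finset.cardsD1 k T) kT in leN.
    - by rewrite inE => /andP[_ /TZ].
    - by rewrite inE => /andP[_ /srcT]; apply.
    - by rewrite !inE => /andP[_ aT] /andP[_ bT]; apply: rhoT.
    - by apply: Uf => l /ksT; rewrite inE => /andP[].
  apply: (subring_gen_sub (adjoin_is_subring _ _) _ fk) => x [a].
  rewrite !inE /= orbF; case=> [[_ ->]|[nak _ nZ ->]|[/andP[_ aT] ->]|[]] //.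
  - by apply: adjoin_base; apply: Avr.
  - have [->|neak] := eqVneq a k; first by apply: adjoin_mem; rewrite !inE eqxx orbT.
    apply: adjoin_base; apply: mem_subring_gen; exists a; apply: Or42.
    by rewrite neak in nak; rewrite inE.
  - by apply: adjoin_base; apply: mem_subring_gen; exists a; apply: Or43; rewrite aT.
have [M fi] := clear i iT; have [M' fj] := clear j jT.
pose P := \prod_(a | a != j) vr S a ^+ natpos (mx S a i).
pose C := \prod_a vr S a ^+ natpos (- mx S a i).
have AP : A P by apply: (subring_prod sA) => a _; apply: (subringX sA).
have C0 : C != 0 by case: gS => _ iS _; apply: monomial_neq0.
have ACV : A C^-1.
  rewrite /C -prodfV; apply: (subring_prod sA) => a _; rewrite -exprVn.
  case ai: (mx S a i) => [c|c]; first by case: c ai => *; apply: (subring1 sA).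
  apply: (subringX sA); apply: mem_subring_gen; exists a; apply: Or42; split=> //.
  + by apply/negP => aT; have := src a aT; rewrite (sk i a) ai; lia.
  + by rewrite inE.
  + by apply/negP => Za; have := srcT a i Za iT; rewrite ai.
have PiE : expol S i = P * vr S j ^+ (natpos (mx S j i)).-1 * vr S j + C.
  rewrite /expol (bigD1 j) //= -/C -/P -mulrA -exprSr prednK 1?mulrC //.
  by case: (mx S j i) ji => -[].
apply: (unit_ideal_clear sA (Avr i) (Avr j) _ _ _ fi fj
  (a := C^-1 * neighbour S i) (b := - (C^-1 * (P * vr S j ^+ (natpos (mx S j i)).-1)))).
- apply: (subringM sA) => //; apply: mem_subring_gen; exists i; apply: Or43.
  by rewrite iT.
- apply: (subringN sA); apply: (subringM sA) => //; apply: (subringM sA) => //.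
  exact: (subringX sA).
- rewrite -mulrA /neighbour divfK ?vr_neq0 // PiE; by field.
Qed.

End LowerBound.

(** * Acyclic source freezing quivers *)

Section QuiverSeed.

Variables (n m : nat) (Q : quiver n m).

(** A rank function for the acyclic quiver. *)
Definition ancestors (i : 'I_n) : nat :=
  #|[pred l | connect (fun i j => (0 < arrows Q (inl i) (inl j))%N) l i]|.

Lemma ancestors_lt i j : acyclic Q -> (0 < arrows Q (inl i) (inl j))%N ->
  (ancestors i < ancestors j)%N.
Proof.
move=> acy ij; apply: proper_card; apply/properP; split.
  apply/fintype.subsetP => l; rewrite !inE => li.
  by apply: connect_trans li _; apply: connect1.
exists j; rewrite !inE ?connect0 //; apply/negP => /connectP[p jp ip].
by have := acy (j :: p); rewrite /= rcons_path jp -ip ij => /(_ isT).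
Qed.

Variables (F : fieldType) (z : 'I_m -> F) (x : {ffun 'I_n -> F}).

Definition quiver_gseed : gseed ('I_n + 'I_m)%type F :=
  GSeed (fun a b => match a, b with
                    | inl a, inl b => quiver_matrix Q a b
                    | inr j, inl b => quiver_coefficients Q b j
                    | inl a, inr j => - quiver_coefficients Q a j
                    | inr _, inr _ => 0
                    end)
        (all_vars z x).

Lemma represents_quiver : contains_group_ring z ->
  freely_generates (frac_ZP z) x -> represents z quiver_gseed (quiver_seed Q x).
Proof.
move=> hZP [hx _]; split=> //; split.
- by move=> [a|a] [b|b] //=; rewrite ?opprK ?oppr0 // !mxE opprB.
- exact: independent_all_vars.
- exact: char_neq2 hZP.
Qed.

Lemma quiver_upper_sub_cluster_algebra : acyclic Q -> source_freezing Q ->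
  represents z quiver_gseed (quiver_seed Q x) ->
  upper_cluster_algebra z (ZPplus z) (quiver_seed Q x)
    `<=` cluster_algebra z (ZPplus z) (quiver_seed Q x).
Proof.
move=> acy src GS f Uf; set G := quiver_gseed in GS.
have [gG _ _ Gx Gz] := GS.
pose T : {set 'I_n + 'I_m} := [set a | ~~ (a \in frozen n m)]%SET.
have FE a : a \notin frozen n m -> exists k, a = inl k.
  by case: a => [k|j]; [exists k|rewrite frozen_inr].
have TE a : a \in T -> exists k, a = inl k by rewrite inE; apply: FE.
pose rho (a : 'I_n + 'I_m) : nat := if a is inl i then ancestors i else 0.
have : mixed_ring (mem (frozen n m)) G T (@finset.set0 _) f.
  apply: (mixed_ring_source (rho := rho)) => //.
  - by move=> a; rewrite inE.
  - move=> _ _ /mapP[j _ ->] /TE[i ->] /=; rewrite !ffunE.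
    suff -> : arrows Q (inr j) (inl i) = 0%N by rewrite subr0.
    by apply/eqP; rewrite -leqn0 leqNgt; apply/negP => /src /= /(_ isT).
  - move=> _ _ /TE[i ->] /TE[j ->] /=; rewrite mxE => ij.
    by apply: ancestors_lt => //; move: ij; rewrite subr_gt0; lia.
  - move=> ks ksT.
    have [ks' ->] : exists ks', ks = map inl ks'.
      elim: ks ksT => [_|a ks IHks ksT]; first by exists [::].
      have [|ks' ->] := IHks; first by move=> k kks; apply: ksT; rewrite inE kks orbT.
      by have [k ->] := TE a (ksT a (mem_head _ _)); exists (k :: ks').
    rewrite -(laurent_ring_represents (represents_foldl ks' GS)).
    set S' := foldl _ _ _; have := Uf (permute_seed 1%g S') _.
    rewrite (_ : cluster (permute_seed 1%g S') = cluster S'); last first.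
      by apply/ffunP => i; rewrite ffunE perm1.
    by apply; exists ks', 1%g.
apply: (subring_gen_sub (subring_gen_is_subring _)) => y [a].
have vars (k : 'I_n) (S' : seed_data F n m) : mutation_equivalent z (quiver_seed Q x) S' ->
    cluster_algebra z (ZPplus z) (quiver_seed Q x) (cluster S' k).
  by move=> eqS; apply: mem_subring_gen; right; exists S'; split=> //; exists k.
have equiv ks : mutation_equivalent z (quiver_seed Q x)
    (permute_seed 1%g (foldl (mutate z) (quiver_seed Q x) ks)) by exists ks, 1%g.
rewrite !inE negbK /= orbF.
case=> [[_ ->]|[/= af _ + _]|[/FE[k ->] ->]|[]] //.
- case: a => [k|j]; last by apply: mem_subring_gen; left; apply: (ZPplus_z z j).
  by have := vars k _ (equiv [::]); rewrite /= ffunE perm1 -Gx.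
- by rewrite af.
- have := vars k _ (equiv [:: k]); rewrite /cluster /= -/(cluster _) ffunE perm1.
  have [_ _ _ <- _] := represents_mutate k GS.
  by rewrite /= eqxx.
Qed.

End QuiverSeed.

Theorem corollary3p8 (n m : nat) (F : fieldType) (z : 'I_m -> F)
    (x : {ffun 'I_n -> F}) (Q : quiver n m)
    (hZP : contains_group_ring z)
    (hseed : is_seed z (quiver_seed Q x))
    (hacyclic : acyclic Q)
    (hsource : source_freezing Q) :
  cluster_algebra z (ZPplus z) (quiver_seed Q x)
  = upper_cluster_algebra z (ZPplus z) (quiver_seed Q x).
Proof.
have /quiver_seedP free_x := hseed.
have GS := represents_quiver Q hZP free_x.
apply/seteqP; split; first exact: cluster_algebra_sub_upper GS.
exact: quiver_upper_sub_cluster_algebra.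
Qed.
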